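(* Let $\mathsf{M}=(\mathbf{X},\mathbf{A},\{\mathbf{A}(x)\}_{x\in\mathbf{X}},Q,\eta,r)$ be a Markov control model satisfying the measurability conditions, with $\mathbf{A}$ compact, and suppose that $\mathsf{M}$ is $\Delta$-absorbing. Let $\mathcal{O}$ be its set of occupancy measures and $\mathcal{C}$ the set of solutions of the characteristic equations. Let $\mu\in\mathcal{O}$ and let $\mathscr{F}(\mu)$ be the face of $\mathcal{O}$ generated by $\mu$. Then: 1. $\mathscr{F}(\mu)=\{\nu\in\mathcal{C}:\nu\le c\mu\text{ for some }c>1\}$. 2. The relative algebraic interior of $\mathscr{F}(\mu)$ is $\mathrm{rai}[\mathscr{F}(\mu)]=\{\nu\in\mathcal{C}:\tfrac1c\mu\le\nu\le c\mu\text{ for some }c>1\}$. 3. The affine hull $\mathrm{aff}\{\mathscr{F}(\mu)\}$ is the set of all $\gamma\in\mathcal{M}(\mathbf{X}\times\mathbf{A})$ such that $(\gamma-\mu)^{\mathbf{X}}=(\gamma-\mu)Q\mathbb{I}_{\Delta^c}$ and $-c\mu\le\gamma-\mu\le c\mu$ for some real $c>0$. 4. The linear subspace of $\mathcal{M}(\mathbf{X}\times\mathbf{A})$ parallel to $\mathrm{aff}\{\mathscr{F}(\mu)\}$ is $$\mathscr{V}(\mu)=\{\nu\in\mathcal{M}(\mathbf{X}\times\mathbf{A}):\nu^{\mathbf{X}}=\nu Q\mathbb{I}_{\Delta^c}\text{ and }-c\mu\le\nu\le c\mu\text{ for some real }c>0\}.$$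
   Context: Notation. For a measurable space $\Omega$, $\mathcal{M}(\Omega)$ is the space of finite signed measures, $\mathcal{M}^{+}(\Omega)$ the set of finite nonnegative measures, $\mathcal{P}(\Omega)$ the set of probability measures. Inequalities between (signed) measures are setwise. For $\nu\in\mathcal{M}(\mathbf{X}\times\mathbf{A})$: $\nu^{\mathbf{X}}(B)=\nu(B\times\mathbf{A})$ is the marginal on $\mathbf{X}$; $\nu Q(B)=\int Q(B|x,a)\,\nu(dx,da)$; and for a signed measure $\lambda$ on $\mathbf{X}$, $\lambda\mathbb{I}_{\Delta^c}(B)=\lambda(B\cap\Delta^c)$, so $\nu Q\mathbb{I}_{\Delta^c}(B)=\int Q(B\cap\Delta^c|x,a)\,\nu(dx,da)$. Model. A control model $\mathsf{M}=(\mathbf{X},\mathbf{A},\{\mathbf{A}(x)\}_{x\in\mathbf{X}},Q,\eta,r)$ consists of: a measurable state space $(\mathbf{X},\mathfrak{X})$; a Borel space $\mathbf{A}$ (action space, with its Borel $\sigma$-algebra $\mathfrak{B}(\mathbf{A})$; standing assumption: $\mathbf{A}$ is compact); nonempty measurable sets $\mathbf{A}(x)\subseteq\mathbf{A}$ of admissible actions, with $\mathbf{K}=\{(x,a)\in\mathbf{X}\times\mathbf{A}:a\in\mathbf{A}(x)\}$; a stochastic kernel $Q$ on $\mathbf{X}$ given $(\mathbf{X}\times\mathbf{A},\mathfrak{X}\otimes\mathfrak{B}(\mathbf{A}))$; an initial distribution $\eta\in\mathcal{P}(\mathbf{X})$; a bounded measurable function $r:\mathbf{X}\times\mathbf{A}\to\mathbb{R}^d$,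 $d\ge1$. It satisfies the measurability conditions if $\mathbf{K}\in\mathfrak{X}\otimes\mathfrak{B}(\mathbf{A})$ and there is a measurable function $\theta:\mathbf{X}\to\mathbf{A}$ with $\theta(x)\in\mathbf{A}(x)$ for all $x$. Policies. $\mathbf{H}_0=\mathbf{X}$ and $\mathbf{H}_n=\mathbf{H}_{n-1}\times\mathbf{A}\times\mathbf{X}$ for $n\ge1$, with product $\sigma$-algebras. A policy $\pi=\{\pi_n\}_{n\ge0}$ is a sequence of stochastic kernels $\pi_n$ on $\mathbf{A}$ given $\mathbf{H}_n$ with $\pi_n(\mathbf{A}(x_n)|h_n)=1$ for all $h_n=(x_0,a_0,\ldots,x_n)\in\mathbf{H}_n$; $\mathbf{\Pi}$ is the set of all policies. For $\pi\in\mathbf{\Pi}$, $\mathbb{P}_\pi$ is the unique probability measure on $(\mathbf{X}\times\mathbf{A})^\infty$, with coordinate processes $(X_n),(A_n)$ and $H_n=(X_0,A_0,\ldots,X_n)$, such that $X_0\sim\eta$, $\mathbb{P}_\pi(A_n\in\cdot\mid H_n)=\pi_n(\cdot|H_n)$ and $\mathbb{P}_\pi(X_{n+1}\in\cdot\mid H_n,A_n)=Q(\cdot|X_n,A_n)$ for all $n$; $\mathbb{E}_\pi$ is the expectation under $\mathbb{P}_\pi$. Absorbing model. For $\Delta\in\mathfrak{X}$, let $T_\Delta=\min\{n\ge0:X_n\in\Delta\}$ ($+\infty$ if there is no such $n$). $\mathsf{M}$ is $\Delta$-absorbing if $Q(\Delta|x,a)=1$ and $r(x,a)=0$ for all $(x,a)\in\Delta\times\mathbf{A}$,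 and $\mathbb{E}_\pi[T_\Delta]<\infty$ for all $\pi\in\mathbf{\Pi}$. Occupancy measures. For $\pi\in\mathbf{\Pi}$, $\mu_\pi(\Gamma)=\mathbb{E}_\pi\big[\sum_{t=0}^\infty \mathbf{1}_{\{T_\Delta>t\}}\mathbf{1}_{\{(X_t,A_t)\in\Gamma\}}\big]$ for $\Gamma\in\mathfrak{X}\otimes\mathfrak{B}(\mathbf{A})$; this is a finite measure. $\mathcal{O}=\{\mu_\pi:\pi\in\mathbf{\Pi}\}$, a convex subset of $\mathcal{M}(\mathbf{X}\times\mathbf{A})$. Characteristic equations. $\mathcal{C}$ is the set of $\mu\in\mathcal{M}^+(\mathbf{X}\times\mathbf{A})$ with $\mu(\mathbf{K}^c)=0$ and $\mu^{\mathbf{X}}=(\eta+\mu Q)\mathbb{I}_{\Delta^c}$. Convexity. A face of a convex set $C$ is a nonempty convex subset $E\subseteq C$ such that $x\in E$, $x=ty+(1-t)z$ with $y,z\in C$, $0<t<1$, imply $y,z\in E$. The face of $C$ generated by $x\in C$ is the smallest face of $C$ containing $x$. $\mathrm{aff}$ denotes the affine hull. The relative algebraic interior $\mathrm{rai}[K]$ of a convex set $K$ is the set of $x\in K$ such that for every line $g$ in $\mathrm{aff}(K)$ containing $x$, $g\cap K$ includes an open segment containing $x$. *)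

(* Defs.v *)
From HB Require Import structures.
From mathcomp Require Import all_boot all_order all_algebra.
From mathcomp Require Import all_classical all_reals all_analysis.

Set Implicit Arguments.
Unset Strict Implicit.
Unset Printing Implicit Defensive.

Import Order.TTheory GRing.Theory Num.Theory.
Import numFieldNormedType.Exports.

Local Open Scope classical_set_scope.
Local Open Scope ring_scope.

Section convexity.
Context {R : realType} {V : lmodType R}.
Implicit Types (C E K L g W : set V) (x y z v p : V).

Definition is_face C E :=
  [/\ E !=set0, convex_set (E : set (convex_lmodType V)), E `<=` C &
    forall x y z (t : R), E x -> C y -> C z -> 0 < t -> t < 1 ->
      x = t *: y + (1 - t) *: z -> E y /\ E z].

Definition face_generated C x : set V := smallest (is_face C) [set x].

Definition affine_set L :=
  forall x y (t : R), L x -> L y -> L (t *: x + (1 - t) *: y).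

Definition aff K : set V := smallest affine_set K.

Definition is_line g :=
  exists p v, v != 0 /\ g = [set p + t *: v | t in [set: R]].

Definition open_segment y z : set V :=
  [set (1 - t) *: y + t *: z | t in `]0, 1[%classic].

(* The endpoints have to be distinct: a degenerate open segment is a point. *)
Definition rai K : set V :=
  [set x | K x /\ forall g, is_line g -> g `<=` aff K -> g x ->
    exists y z, [/\ y != z, open_segment y z x &
      open_segment y z `<=` g `&` K]].

Definition linear_subspace W :=
  W 0 /\ forall (a : R) x y, W x -> W y -> W (a *: x + y).

Definition parallel_subspace L W :=
  linear_subspace W /\ exists p, L = [set p + v | v in W].

End convexity.

(* The values of a signed measure at non-measurable sets are irrelevant; they
   are set to 0 so that equality in signed_measure T R is equality on the
   sigma-algebra, which makes signed_measure T R a vector space. *)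
Section signed_measures.
Context d (T : measurableType d) (R : realType).

Definition is_signed_measure (m : set T -> R^o) :=
  [/\ m set0 = 0, semi_sigma_additive (fun B => (m B)%:E) &
    forall B, ~ measurable B -> m B = 0].

Definition signed_measure_pred : {pred set T -> R^o} :=
  fun m => `[< is_signed_measure m >].

Lemma signed_measure_submod_closed : submod_closed signed_measure_pred.
Proof.
split=> [|a m1 m2 /asboolP[m10 m1s m1n] /asboolP[m20 m2s m2n]].
  apply/asboolP; split=> // F mF tF mUF.
  rewrite (_ : (fun _ => _) = cst 0%E); first exact: cvg_cst.
  by apply/funext => n; rewrite big1.
apply/asboolP; split=> [|F mF tF mUF|B nB].
- by rewrite !fctE m10 m20 scaler0 addr0.
- have h1 := m1s F mF tF mUF; have h2 := m2s F mF tF mUF.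
  rewrite (_ : (fun n => _) = (fun n => a%:E * (\sum_(0 <= i < n) (m1 (F i))%:E)
     + \sum_(0 <= i < n) (m2 (F i))%:E)%E).
    rewrite !fctE EFinD EFinM; apply: cvgeD => //; exact: cvgeZl.
  by apply/funext => n; rewrite !sumEFin -EFinM -EFinD mulr_sumr -big_split.
- by rewrite !fctE m1n// m2n// scaler0 addr0.
Qed.

HB.instance Definition _ := GRing.isSubmodClosed.Build _ _ signed_measure_pred
  signed_measure_submod_closed.

Record signed_measure := SignedMeasure {
  signed_measure_fun :> set T -> R^o ;
  _ : signed_measure_fun \in signed_measure_pred }.

HB.instance Definition _ := [isSub for signed_measure_fun].
HB.instance Definition _ := [Choice of signed_measure by <:].
HB.instance Definition _ := [SubChoice_isSubLmodule of signed_measure by <:].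

Definition charge_of (m : signed_measure) : set T -> \bar R :=
  fun B => (m B)%:E.

Section charge_of.
Variable m : signed_measure.

Let charge_of0 : charge_of m set0 = 0%E.
Proof. by have /asboolP[m0 _ _] := valP m; rewrite /charge_of; congr EFin. Qed.

Let charge_of_fin B : measurable B -> charge_of m B \is a fin_num.
Proof. by []. Qed.

Let charge_of_sigma_additive : semi_sigma_additive (charge_of m).
Proof. by have /asboolP[] := valP m. Qed.

HB.instance Definition _ := isCharge.Build _ _ _ (charge_of m)
  charge_of0 charge_of_fin charge_of_sigma_additive.
End charge_of.

Lemma hahn_exists (m : signed_measure) :
  exists PN, hahn_decomposition (charge_of m) PN.1 PN.2.
Proof.
by have [P [N PN]] := Hahn_decomposition (charge_of m); exists (P, N).
Qed.

Definition hahn m := projT2 (cid (hahn_exists m)).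

Definition signed_integral (m : signed_measure) (f : T -> \bar R) : \bar R :=
  (\int[jordan_pos (hahn m)]_x f x - \int[jordan_neg (hahn m)]_x f x)%E.

Definition setwise_le (m1 m2 : signed_measure) :=
  forall B, measurable B -> m1 B <= m2 B.

End signed_measures.

Notation "m1 <=: m2" := (setwise_le m1 m2) (at level 70, no associativity).

Notation borel A := (g_sigma_algebraType (@open A)).

(* A Borel space: homeomorphic to a Borel subset of a complete separable metric
   space (a metric space being a Hausdorff pseudometric one). *)
Definition borel_space (R : realType) (A : topologicalType) :=
  exists (S : completePseudoMetricType R) (f : A -> S),
    [/\ hausdorff_space S,
        exists2 D : set S, countable D & dense D,
        injective f,
        forall U : set A, open U <-> exists2 O : set S, open O & U = f @^-1` O &
        <<s @open S >> (range f)].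

Section histories.
Context dX (X : measurableType dX) dA (A : measurableType dA).

Fixpoint hist_space (n : nat) : {d : measure_display & measurableType d} :=
  match n with
  | 0 => existT _ dX X
  | m.+1 => existT (fun d => measurableType d) _
      ((projT2 (hist_space m) * A * X)%type : measurableType _)
  end.

Definition hist n : measurableType (projT1 (hist_space n)) :=
  projT2 (hist_space n).

Definition hist_last n : hist n -> X :=
  match n return hist n -> X with
  | 0 => fun h => h
  | m.+1 => fun h => h.2
  end.

Definition cylinders : set (set (nat -> X * A)) :=
  \bigcup_n preimage_set_system setT (fun w : nat -> X * A => w n) measurable.

Definition trajectory := g_sigma_algebraType cylinders.

Definition state_at (n : nat) (w : trajectory) : X := (w n).1.
Definition action_at (n : nat) (w : trajectory) : A := (w n).2.

Fixpoint history (n : nat) (w : trajectory) : hist n :=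
  match n return hist n with
  | 0 => state_at 0 w
  | m.+1 => (history m w, action_at m w, state_at m.+1 w)
  end.

End histories.

Arguments hist_last {dX X dA A n} h.

(* k(Y, .) is the conditional distribution of Z given Y under P. *)
Definition conditional_law d (W : measurableType d) (R : realType)
    (P : probability W R) d1 (T1 : measurableType d1) d2 (T2 : measurableType d2)
    (Y : W -> T1) (Z : W -> T2) (k : T1 -> set T2 -> \bar R) :=
  forall (B : set T1) (C : set T2), measurable B -> measurable C ->
    P (Y @^-1` B `&` Z @^-1` C) = (\int[P]_(w in Y @^-1` B) k (Y w) C)%E.

Section control_models.
Context (R : realType) dX (X : measurableType dX) (A : ptopologicalType)
  (dim : nat).

Record control_model := ControlModel {
  admissible : X -> set (borel A) ;
  admissible_neq0 : forall x, admissible x !=set0 ;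
  measurable_admissible : forall x, measurable (admissible x) ;
  transition : R.-pker (X * borel A) ~> X ;
  initial : probability X R ;
  reward : X * borel A -> 'rV[R]_dim ;
  measurable_reward : forall i, measurable_fun setT (fun z => reward z ord0 i) ;
  bounded_reward : exists c : R, forall z i, `|reward z ord0 i| <= c }.

Variable M : control_model.

Definition admissible_graph : set (X * borel A) :=
  [set z | admissible M z.1 z.2].

Definition measurability_conditions :=
  measurable admissible_graph /\
  exists theta : X -> borel A,
    measurable_fun setT theta /\ forall x, admissible M x (theta x).

Record policy := Policy {
  policy_kernel :> forall n, R.-pker (hist X (borel A) n) ~> borel A ;
  policy_admissible : forall n (h : hist X (borel A) n),
    policy_kernel n h (admissible M (hist_last h)) = 1%E }.

(* P is the probability measure P_pi of the canonical process; it exists and is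
   unique by the Ionescu-Tulcea theorem. *)
Definition strategic_measure (pi : policy)
    (P : probability (trajectory X (borel A)) R) :=
  [/\ forall B : set X, measurable B -> P (state_at 0 @^-1` B) = initial M B,
      forall n, conditional_law P (history n) (action_at n) (fun h => pi n h) &
      forall n, conditional_law P (fun w => (history n w, action_at n w))
        (state_at n.+1) (fun ha => transition M (hist_last ha.1, ha.2))].

Variable Delta : set X.

Definition hitting_time (w : trajectory X (borel A)) : \bar R :=
  ereal_inf [set n%:R%:E | n in [set n | Delta (state_at n w)]].

Definition absorbing :=
  (forall x a, Delta x -> transition M (x, a) Delta = 1%E /\ reward M (x, a) = 0)
  /\ forall (pi : policy) (P : probability (trajectory X (borel A)) R),
      strategic_measure pi P -> (\int[P]_w hitting_time w < +oo)%E.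

Definition occupancy (P : probability (trajectory X (borel A)) R)
    (G : set (X * borel A)) : \bar R :=
  (\int[P]_w \sum_(0 <= t <oo)
     (\1_[set w' | (t%:R%:E < hitting_time w')%E] w *
      \1_[set w' | G (state_at t w', action_at t w')] w)%:E)%E.

Definition occupancy_measures : set (signed_measure (X * borel A)%type R) :=
  [set mu | exists (pi : policy) (P : probability (trajectory X (borel A)) R),
    strategic_measure pi P /\
    forall G, measurable G -> (mu G)%:E = occupancy P G].

Definition marginal (nu : signed_measure (X * borel A)%type R) (B : set X)
  : \bar R := (nu (B `*` [set: borel A]))%:E.

(* nu Q restricted to the complement of Delta *)
Definition kernel_push (nu : signed_measure (X * borel A)%type R) (B : set X)
  : \bar R := signed_integral nu (fun z => transition M z (B `&` ~` Delta)).

Definition characteristic_solutions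
  : set (signed_measure (X * borel A)%type R) :=
  [set mu | [/\ 0 <=: mu, mu (~` admissible_graph) = 0 &
    forall B, measurable B ->
      marginal mu B = (initial M (B `&` ~` Delta) + kernel_push mu B)%E]].

Definition flow_invariant (nu : signed_measure (X * borel A)%type R) :=
  forall B, measurable B -> marginal nu B = kernel_push nu B.

End control_models.

(* Main.v *)
(** The crux is that a solution [nu] of the characteristic equations with
    [nu <= c mu], [mu] an occupancy measure, is itself an occupancy measure.
    Since the action space is compact, it is a measurable retract of the Cantor
    space, so [nu] disintegrates along a Markov kernel [phi]; following [phi]
    forever defines a policy by the Ionescu-Tulcea theorem. Unfolding the
    characteristic equations [n] times writes [nu] as the sum of the first [n]
    laws of that policy before absorption, plus the [nu]-integral of the
    probability [u_n] of surviving [n] more steps. The sequence [u_n] decreases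
    to a limit [v], and [v] vanishes [mu]-almost everywhere: switching from the
    policy of [mu] to [phi] at time [t] is again absorbed in finite mean time,
    so [v] vanishes almost everywhere for each law making up [mu]. By
    domination [v] vanishes [nu]-almost everywhere and the remainder tends to 0.
    The converse, that occupancy measures solve the equations, is immediate; the
    face, its interior and its affine hull are then linear algebra. *)

From HB Require Import structures.
From mathcomp Require Import all_boot all_order all_algebra.
From mathcomp Require Import all_classical all_reals all_analysis.
From mathcomp Require Import measurable_realfun ring lra.
Require Import Defs.

Set Implicit Arguments.
Unset Strict Implicit.
Unset Printing Implicit Defensive.

Import Order.TTheory GRing.Theory Num.Theory.
Import numFieldNormedType.Exports.

Local Open Scope classical_set_scope.
Local Open Scope ring_scope.

(** * Positive functionals and measures *)

Section positive_functionals.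
Local Open Scope ereal_scope.
Context d (T : measurableType d) (R : realType).

(** A solution of the characteristic equations need not be an occupancy measure: it may carry mass
    that circulates off [Delta] for ever without being fed by the initial distribution. The limit
    [v] detects such mass, and absorption controls [v] only along laws that start from the initial
    distribution. The laws known to make up [mu] are those of [pi], whereas [v] belongs to the
    kernel [phi] taken from [nu]; this mismatch is what forces the hybrid policies. Domination
    enters there as absolute continuity alone; the size of [c] matters only for the geometry. The
    state space is an arbitrary measurable space, so the disintegration may use structure on the
    actions only: bit sequences reduce it to countably many Radon-Nikodym derivatives with respect
    to the state marginal. The kernel so obtained is admissible almost everywhere, and the selector
    [theta] repairs it on the exceptional null set. In the geometry the characteristic equations
    survive only as flow invariance of [nu - mu], a linear condition, since the initial distribution
    cancels in the difference. *)

Definition ge0mfun (f : T -> \bar R) :=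
  (forall x, 0 <= f x) /\ measurable_fun [set: T] f.

Lemma ge0mfun_indic (U : set T) : measurable U ->
  ge0mfun (fun x => (\1_U x)%:E).
Proof.
move=> mU; split=> [x|]; first by rewrite lee_fin.
exact/measurable_EFinP/measurable_indic.
Qed.

Lemma ge0mfunZ (c : R) (f : T -> \bar R) : (0 <= c)%R -> ge0mfun f ->
  ge0mfun (fun x => c%:E * f x).
Proof.
move=> c0 [f0 mf]; split=> [x|]; first by rewrite mule_ge0.
exact: measurable_funeM.
Qed.

(** Daniell-style axioms. They are stable under composition, so every iterated integral against
    kernels satisfies them and can be identified with an integral by testing indicators only. *)
Record positive_functional (Phi : (T -> \bar R) -> \bar R) := {
  pfunctionalD : forall f g, ge0mfun f -> ge0mfun g ->
    Phi (fun x => f x + g x) = Phi f + Phi g ;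
  pfunctionalZ : forall (c : R) f, (0 <= c)%R -> ge0mfun f ->
    Phi (fun x => c%:E * f x) = c%:E * Phi f ;
  pfunctional_le : forall f g, ge0mfun f -> ge0mfun g ->
    (forall x, f x <= g x) -> Phi f <= Phi g ;
  pfunctional_cvg : forall (g : (T -> \bar R)^nat) f,
    (forall n, ge0mfun (g n)) ->
    (forall x, nondecreasing_seq (g ^~ x)) ->
    (forall x, g n x @[n --> \oo] --> f x) ->
    Phi (g n) @[n --> \oo] --> Phi f }.

Lemma positive_functional_integral (m : {measure set T -> \bar R}) :
  positive_functional (fun f => \int[m]_x f x).
Proof.
split=> [f g [f0 mf] [g0 mg]|c f c0 [f0 mf]|f g [f0 mf] [g0 mg] fg|
  g f mg ndg gf].
- by rewrite ge0_integralD.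
- by rewrite ge0_integralZl.
- by apply: ge0_le_integral => // x _; exact: fg.
- rewrite (_ : (\int[m]_x f x) = \int[m]_x limn (g ^~ x)); last first.
    by apply: eq_integral => x _; apply/esym/cvg_lim.
  apply: cvg_monotone_convergence => //.
  + by move=> n; case: (mg n).
  + by move=> n x _; case: (mg n).
Qed.

Import HBNNSimple.

(** The standard machine, run once for all: indicators, then simple functions by linearity, then
    increasing limits. *)
Lemma positive_functionalE (m : {measure set T -> \bar R}) Phi :
  positive_functional Phi ->
  (forall U, measurable U -> Phi (fun x => (\1_U x)%:E) = m U) ->
  forall f, ge0mfun f -> Phi f = \int[m]_x f x.
Proof.
move=> Phi_pos Phi1 f [f0 mf].
have iint := positive_functional_integral m.
have Phi0 : Phi (fun=> 0) = 0.
  have := Phi1 _ measurable0; rewrite measure0 => Phi10; rewrite -[RHS]Phi10.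
  by congr (Phi _); apply/funext => x; rewrite indic0.
pose g := nnsfun_approx measurableT mf.
have Phig n : Phi (EFin \o g n) = \int[m]_x (g n x)%:E.
  (* The simple function is written as a sum over a list of its values, so that additivity and
     homogeneity can be used by induction on the list. *)
  have [s s0 gE] : exists2 s : seq R, {in s, forall y, (0 <= y)%R} &
      EFin \o g n = fun x =>
        \sum_(y <- s) (y%:E * (\1_(g n @^-1` [set y]) x)%:E).
    exists (finmap.enum_fset (fset_set (range (g n)))) => [y|].
      by rewrite in_fset_set ?inE// => -[x _ <-].
    apply/funext => x; rewrite /= fimfunE (fsbig_finite _ _ (fimfunP (g n)))/=.
    by rewrite -sumEFin; apply: eq_bigr => i _; rewrite EFinM.
  rewrite (_ : (fun x => (g n x)%:E) = EFin \o g n)// gE {gE}.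
  elim: s s0 => [|y s IH] yS.
    by rewrite (_ : (fun _ => _) = fun=> 0) ?Phi0 ?integral0//;
      apply/funext => x; rewrite big_nil.
  have y0 : (0 <= y)%R by apply: yS; rewrite inE eqxx.
  have mY : measurable (g n @^-1` [set y]) by [].
  have sS z : z \in s -> (0 <= z)%R by move=> zs; apply: yS; rewrite inE zs orbT.
  have ms : ge0mfun (fun x =>
      \sum_(y <- s) (y%:E * (\1_(g n @^-1` [set y]) x)%:E)).
    split=> [x|].
      by rewrite big_seq; apply: sume_ge0 => z /sS z0; rewrite mule_ge0// lee_fin.
    apply: emeasurable_sum => z; apply: measurable_funeM.
    exact/measurable_EFinP/measurable_indic.
  transitivity (Phi (fun x => (y%:E * (\1_(g n @^-1` [set y]) x)%:E)
      + \sum_(y <- s) (y%:E * (\1_(g n @^-1` [set y]) x)%:E))).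
    by congr (Phi _); apply/funext => x; rewrite big_cons.
  rewrite (pfunctionalD Phi_pos)//; last first.
    by apply: ge0mfunZ => //; exact: ge0mfun_indic.
  rewrite (pfunctionalZ Phi_pos)//; last exact: ge0mfun_indic.
  rewrite Phi1// IH//.
  have mI := ge0mfun_indic mY.
  have hD := pfunctionalD iint (ge0mfunZ y0 mI) ms.
  have hZ := pfunctionalZ iint y0 mI.
  under [RHS]eq_integral do rewrite big_cons.
  by rewrite [RHS]hD hZ integral_indic// setIT.
have gE n : ge0mfun (EFin \o g n).
  by split=> [x|]; [rewrite /= lee_fin|exact/measurable_EFinP].
have ndg x : nondecreasing_seq (fun n => (EFin \o g n) x).
  by move=> a b ab; rewrite lee_fin; exact/lefP/nd_nnsfun_approx.
have gf x : (EFin \o g n) x @[n --> \oo] --> f x by exact: cvg_nnsfun_approx.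
have h1 := pfunctional_cvg Phi_pos gE ndg gf.
have h2 := pfunctional_cvg iint gE ndg gf.
move/cvg_lim : h1 => <-//; move/cvg_lim : h2 => <-//.
by apply/congr_lim/funext => n; exact: Phig.
Qed.

End positive_functionals.

Section compositions.
Local Open Scope ereal_scope.
Context d1 d2 (X : measurableType d1) (Y : measurableType d2) (R : realType).

Lemma positive_functional_comp (Phi : (X -> \bar R) -> \bar R)
    (L : (Y -> \bar R) -> X -> \bar R) :
  positive_functional Phi -> (forall f, ge0mfun f -> ge0mfun (L f)) ->
  (forall x, positive_functional (L ^~ x)) ->
  positive_functional (fun f => Phi (L f)).
Proof.
move=> PhiP mL LP; split=> [f g mf mg|c f c0 mf|f g mf mg fg|g f mg ndg gf].
- rewrite -(pfunctionalD PhiP); [|exact: mL..].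
  by congr (Phi _); apply/funext => x; exact: (pfunctionalD (LP x)).
- rewrite -(pfunctionalZ PhiP) //; [|exact: mL..].
  by congr (Phi _); apply/funext => x; exact: (pfunctionalZ (LP x)).
- apply: (pfunctional_le PhiP); [exact: mL..|move=> x].
  exact: (pfunctional_le (LP x)).
- apply: (pfunctional_cvg PhiP) => [n|x a b ab|x].
  + exact: mL.
  + by apply: (pfunctional_le (LP x)) => // y; exact: ndg.
  + exact: (pfunctional_cvg (LP x)).
Qed.

Lemma ge0mfun_comp (h : X -> Y) (f : Y -> \bar R) : measurable_fun setT h ->
  ge0mfun f -> ge0mfun (f \o h).
Proof.
by move=> mh [f0 mf]; split=> [x|]; [exact: f0|exact: measurableT_comp].
Qed.

Lemma positive_functional_precomp (Phi : (X -> \bar R) -> \bar R)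
    (h : X -> Y) : measurable_fun setT h -> positive_functional Phi ->
  positive_functional (fun f => Phi (f \o h)).
Proof.
move=> mh PhiP.
apply: (@positive_functional_comp Phi (fun f => f \o h)) => // [f|x].
  exact: ge0mfun_comp.
by split=> // f g _ _; exact.
Qed.

Lemma ge0mfun_kernel (k : R.-ker X ~> Y) (f : Y -> \bar R) : ge0mfun f ->
  ge0mfun (fun x => \int[k x]_y f y).
Proof.
move=> [f0 mf]; split=> [x|]; first exact: integral_ge0.
by apply: measurable_fun_integral_kernel => // U mU; exact: measurable_kernel.
Qed.

Section bind_measure.
Variables (m : {measure set X -> \bar R}) (k : R.-ker X ~> Y).
Variables (D : set X) (mD : measurable D).

(** The mixture of the [k x] under [m]. The domain [D] is a parameter so that the side [B] of a
    rectangle can be frozen while the other side varies. *)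
Definition bind_fun (U : set Y) := \int[m]_(x in D) k x U.

Let bind0 : bind_fun set0 = 0.
Proof. by rewrite /bind_fun integral0_eq. Qed.

Let bind_ge0 U : 0 <= bind_fun U. Proof. exact: integral_ge0. Qed.

Let bind_sigma_additive : semi_sigma_additive bind_fun.
Proof.
move=> U mU tU mUU; rewrite [X in _ --> X](_ : _ =
    \int[m]_(x in D) \sum_(n <oo) k x (U n)); last first.
  apply: eq_integral => x _; apply/esym/cvg_lim => //.
  exact/measure_semi_sigma_additive.
apply/cvg_closeP; split.
  by apply: is_cvg_nneseries => n _ _; exact: integral_ge0.
rewrite closeE// integral_nneseries// => n.
exact/measurable_funTS/measurable_kernel.
Qed.

HB.instance Definition _ := isMeasure.Build _ _ _ bind_fun
  bind0 bind_ge0 bind_sigma_additive.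

Definition bind_measure : {measure set Y -> \bar R} := bind_fun.

Lemma bind_measureE U : bind_measure U = \int[m]_(x in D) k x U.
Proof. by []. Qed.

End bind_measure.

Lemma integral_bind (m : {measure set X -> \bar R}) (k : R.-ker X ~> Y)
    (n : {measure set Y -> \bar R}) :
  (forall U, measurable U -> n U = \int[m]_x k x U) ->
  forall f, ge0mfun f -> \int[n]_y f y = \int[m]_x \int[k x]_y f y.
Proof.
move=> nE f mf; apply/esym; move: f mf.
apply: (@positive_functionalE _ _ _ n (fun f => \int[m]_x \int[k x]_y f y)).
  apply: (@positive_functional_comp _ (fun f x => \int[k x]_y f y)).
  - exact: positive_functional_integral.
  - exact: ge0mfun_kernel.
  - by move=> x; exact: positive_functional_integral.
move=> U mU; rewrite nE//; apply: eq_integral => x _.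
by rewrite integral_indic// setIT.
Qed.

End compositions.

Lemma measure_prod_eq d1 d2 (X : measurableType d1) (Y : measurableType d2)
    (R : realType) (m1 m2 : {measure set (X * Y) -> \bar R}) :
  (m1 setT < +oo)%E ->
  (forall B C, measurable B -> measurable C -> m1 (B `*` C) = m2 (B `*` C)) ->
  forall G, measurable G -> m1 G = m2 G.
Proof.
move=> m1oo m12 G mG.
apply: (@measure_unique _ R (X * Y)%type
  [set A `*` B | A in measurable & B in measurable] (fun=> setT)) => //.
- by rewrite measurable_prod_measurableType.
- move=> _ _ [A1 mA1 [B1 mB1 <-]] [A2 mA2 [B2 mB2 <-]].
  exists (A1 `&` A2); first exact: measurableI.
  by exists (B1 `&` B2); [exact: measurableI|rewrite setXI].
- by move=> _; exists setT => //; exists setT => //; rewrite setXTT.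
- by rewrite bigcup_const//; exists 0%N.
- by move=> _ [A mA [B mB <-]]; exact: m12.
Qed.

Section image_measure.
Local Open Scope ereal_scope.
Context d1 d2 (X : measurableType d1) (Y : measurableType d2) (R : realType).
Context (h : X -> Y) (mh : measurable_fun [set: X] h).

Definition image_measure (m : {measure set X -> \bar R}) :
  {measure set Y -> \bar R}.
Proof. by refine (pushforward m h : {measure set Y -> \bar R}). Defined.

Lemma image_measureE m U : image_measure m U = m (h @^-1` U).
Proof. by []. Qed.

Lemma integral_image_measure m f : ge0mfun f ->
  \int[image_measure m]_y f y = \int[m]_x f (h x).
Proof. by move=> [f0 mf]; rewrite ge0_integral_pushforward. Qed.

End image_measure.

Section measure_packing.
Context d (T : measurableType d) (R : realType) (m : {measure set T -> \bar R}).

(** An alias that carries the proof as an argument, so that the finite-measure structure can be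
    attached to it. *)
Definition as_finite (fm : fin_num_fun m) : set T -> \bar R := m.
HB.instance Definition _ fm := Measure.copy (as_finite fm) m.
HB.instance Definition _ fm := Measure_isFinite.Build _ _ _ (as_finite fm) fm.
Definition finite_measure_of fm : {finite_measure set T -> \bar R} :=
  as_finite fm.

Definition as_probability (m1 : m setT = 1%E) : set T -> \bar R := m.
HB.instance Definition _ m1 := Measure.copy (as_probability m1) m.
HB.instance Definition _ m1 :=
  Measure_isProbability.Build _ _ _ (as_probability m1) m1.
Definition probability_of m1 : probability T R := as_probability m1.

End measure_packing.

(** * The Ionescu-Tulcea theorem *)

Section ionescu_tulcea.
Local Open Scope ereal_scope.
Context dX (X : measurableType dX) dA (A : measurableType dA) (R : realType).
Local Notation Omega := (trajectory X A).

Lemma measurable_coord n : measurable_fun setT (fun w : Omega => w n).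
Proof.
move=> _ B mB; rewrite setTI; apply: sub_sigma_algebra.
by exists n => //; exists B => //; rewrite setTI.
Qed.

Lemma measurable_into_trajectory d (Z : measurableType d) (f : Z -> Omega) :
  (forall n, measurable_fun setT (fun z => f z n)) -> measurable_fun setT f.
Proof.
move=> mf; apply: (@measurability _ _ _ Omega setT f (@cylinders _ X _ A)) => //.
move=> _ [_ [n _ [B mB <-]] <-]; rewrite !setTI.
by have := mf n measurableT B mB; rewrite setTI.
Qed.

(** Together with measurability this plays the part of measurability with respect to the first [n]
    coordinates, without leaving the trajectory space. *)
Definition depends_below T (n : nat) (f : Omega -> T) :=
  forall w w', (forall i, (i < n)%N -> w i = w' i) -> f w = f w'.

Lemma depends_belowW T m n (f : Omega -> T) : (m <= n)%N ->
  depends_below m f -> depends_below n f.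
Proof. by move=> mn fm w w' ww'; apply: fm => i im; apply/ww'/(leq_trans im). Qed.

Definition update n (w : Omega) (y : X * A) : Omega :=
  fun i => if i == n then y else w i.

Lemma update_lt n w y i : (i < n)%N -> update n w y i = w i.
Proof. by move=> i_n; rewrite /update ltn_eqF. Qed.

Lemma measurable_update n :
  measurable_fun setT (fun wy : Omega * (X * A) => update n wy.1 wy.2).
Proof.
apply: measurable_into_trajectory => i; rewrite /update.
case: (i == n); first exact: measurable_snd.
exact: (measurableT_comp (measurable_coord i) measurable_fst).
Qed.

Lemma measurable_update2 n w : measurable_fun setT (update n w).
Proof. exact: measurable_fun_pair2 (measurable_update n). Qed.

Variable k : forall n : nat, R.-pker Omega ~> (X * A)%type.
Hypothesis k_dep : forall n, depends_below n (fun w => k n w).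

(** Integrates coordinate [n] out, as a conditional expectation given the earlier ones. The kernels
    read a whole trajectory, [k_dep] restricting them to its first [n] coordinates, so that all
    times share one space. *)
Definition step n (f : Omega -> \bar R) (w : Omega) :=
  \int[k n w]_y f (update n w y).

Lemma ge0mfun_step n f : ge0mfun f -> ge0mfun (step n f).
Proof.
move=> [f0 mf]; split=> [w|]; first exact: integral_ge0.
apply: (measurable_fun_integral_finite_kernel
  (fun wy => f (update n wy.1 wy.2)) (k n)) => //.
exact: measurableT_comp mf (measurable_update n).
Qed.

Lemma positive_functional_step n w : positive_functional (step n ^~ w).
Proof.
exact: (positive_functional_precomp (measurable_update2 n w)
  (positive_functional_integral _)).
Qed.

Lemma depends_below_step n f : depends_below n.+1 f ->
  depends_below n (step n f).
Proof.
move=> fn w w' ww'; rewrite /step (k_dep ww'); apply: eq_integral => y _.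
apply: fn => i; rewrite ltnS leq_eqVlt => /predU1P[->|i_n].
  by rewrite /update eqxx.
by rewrite !update_lt// ww'.
Qed.

Lemma step_id n f : depends_below n f -> step n f = f.
Proof.
move=> fn; apply/funext => w; rewrite /step.
rewrite (eq_integral (cst (f w))) => [|y _].
  by rewrite integral_cst//= prob_kernel mule1.
by apply: fn => i i_n; rewrite update_lt.
Qed.

(** Coordinates [m] to [m + j - 1] are integrated out, the last one innermost. *)
Fixpoint steps (j m : nat) (f : Omega -> \bar R) : Omega -> \bar R :=
  if j is j'.+1 then step m (steps j' m.+1 f) else f.

Lemma stepsSr j m f : steps j.+1 m f = steps j m (step (m + j) f).
Proof.
elim: j m => [|j IH] m /=; first by rewrite addn0.
by rewrite -addSnnS -IH.
Qed.

Lemma steps_id j m f : depends_below m f -> steps j m f = f.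
Proof.
elim: j m f => [//|j IH] m f fm /=.
by rewrite IH ?step_id//; exact: depends_belowW fm.
Qed.

(** Kolmogorov consistency: the kernels have mass 1, so integrating coordinates on which [f] does
    not depend changes nothing. *)
Lemma steps_stable N m j j' f : depends_below N f -> (N <= m + j)%N ->
  (N <= m + j')%N -> steps j m f = steps j' m f.
Proof.
move=> fN; wlog jj' : j j' / (j <= j')%N.
  move=> H h h'; have [/H|/ltnW/H] := leqP j j'; first exact.
  by move=> H'; rewrite -H'.
move=> Nj _; rewrite -(subnKC jj'); elim: (j' - j)%N => [|n IH].
  by rewrite addn0.
rewrite addnS stepsSr step_id//; apply: depends_belowW fN.
by rewrite addnA (leq_trans Nj)// leq_addr.
Qed.

Lemma ge0mfun_steps j m f : ge0mfun f -> ge0mfun (steps j m f).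
Proof. by elim: j m f => [//|j IH] m f mf; exact/ge0mfun_step/IH. Qed.

Lemma positive_functional_steps j m w : positive_functional (steps j m ^~ w).
Proof.
elim: j m w => [|j IH] m w; first by split => // f g _ _; exact.
apply: (@positive_functional_comp _ _ _ _ _ (step m ^~ w) (steps j m.+1)) => //.
- exact: positive_functional_step.
- by move=> f; exact: ge0mfun_steps.
Qed.

(** An alias of the trajectory space whose declared measurable sets are the cylinders only. These
    form an algebra, from which the Caratheodory extension starts. *)
Definition cylinder_type : Type := Omega.
HB.instance Definition _ := Pointed.on cylinder_type.

Definition cylinder : set (set cylinder_type) :=
  [set B | (measurable : set (set Omega)) B /\ exists n, depends_below n B].

Lemma cylinder0 : cylinder set0.
Proof. by split; [exact: measurable0|exists 0%N]. Qed.

Lemma cylinderU : setU_closed cylinder.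
Proof.
move=> B C [mB [n Bn]] [mC [m Cm]]; split; first exact: measurableU.
exists (maxn n m) => w w' ww'; rewrite /setU/=.
by rewrite (depends_belowW (leq_maxl n m) Bn ww')
  (depends_belowW (leq_maxr n m) Cm ww').
Qed.

Lemma cylinderC : setC_closed cylinder.
Proof.
move=> B [mB [n Bn]]; split; first exact: measurableC.
by exists n => w w' ww'; rewrite /setC/= (Bn _ _ ww').
Qed.

Definition cylinder_display : measure_display. Proof. by constructor. Qed.

HB.instance Definition _ := @isAlgebraOfSets.Build cylinder_display cylinder_type
  cylinder cylinder0 cylinderU cylinderC.

Let base : Omega := point.

(** All coordinates on which the indicator depends are integrated out, so the starting trajectory
    [base] does not influence the value; 0 is a default for sets that depend on infinitely many
    coordinates. *)
Definition cyl_content (B : set cylinder_type) : \bar R :=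
  if pselect (exists n, depends_below n B) is left h
  then steps (projT1 (cid h)) 0 (fun w => (\1_B w)%:E) base else 0.

Lemma depends_below_indic n (B : set Omega) : depends_below n B ->
  depends_below n (fun w => (\1_B w)%:E : \bar R).
Proof.
move=> Bn w w' ww'; rewrite !indicE.
suff -> : (w \in B) = (w' \in B) by [].
by apply/idP/idP; rewrite !inE (Bn _ _ ww').
Qed.

Lemma cyl_contentE n (B : set Omega) : depends_below n B ->
  cyl_content B = steps n 0 (fun w => (\1_B w)%:E) base.
Proof.
move=> Bn; rewrite /cyl_content; case: pselect => [h|]; last by case; exists n.
case: cid => m /= Bm; congr (_ base).
have [mn|nm] := leqP m n.
  by apply: (steps_stable (depends_below_indic Bm)).
by apply: (steps_stable (depends_below_indic Bn)) => //; exact: ltnW.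
Qed.

Lemma cyl_content_setT : cyl_content setT = 1.
Proof. by rewrite (@cyl_contentE 0)//= indicT. Qed.

Let cyl_content0 : cyl_content set0 = 0.
Proof. by rewrite (@cyl_contentE 0)//= indic0. Qed.

Let cyl_content_ge0 B : 0 <= cyl_content B.
Proof.
rewrite /cyl_content; case: pselect => // h; case: cid => n /= _.
elim: n (0%N) base => [|n IH] m w /=; first by rewrite lee_fin.
by apply: integral_ge0 => y _; exact: IH.
Qed.

Let cyl_content_additive : measure_function.semi_additive cyl_content.
Proof.
apply/(additive2P cyl_content0) => B C [mB [n Bn]] [mC [m Cm]] BC0.
have {}Bn := depends_belowW (leq_maxl n m) Bn.
have {}Cm := depends_belowW (leq_maxr n m) Cm.
have BCn : depends_below (maxn n m) (B `|` C).
  by move=> w w' ww'; rewrite /setU/= (Bn _ _ ww') (Cm _ _ ww').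
rewrite (cyl_contentE Bn) (cyl_contentE Cm) (cyl_contentE BCn).
rewrite -(pfunctionalD (positive_functional_steps _ _ _)); last 2 first.
- exact: ge0mfun_indic.
- exact: ge0mfun_indic.
congr (steps _ _ _ _); apply/funext => w.
rewrite !indicE in_setU -EFinD -natrD.
case: (boolP (w \in B)) => [/[!inE] Bw|_]; case: (boolP (w \in C)) => // /[!inE] Cw.
by have : (B `&` C) w by []; rewrite BC0.
Qed.

HB.instance Definition _ := isContent.Build _ _ _ cyl_content
  cyl_content_ge0 cyl_content_additive.

(** Otherwise [f - c] would be positive everywhere with integral 0, hence null almost everywhere,
    which total mass 1 forbids. This is how the next coordinate of a trajectory gets chosen. *)
Lemma exists_le_integral d (T : measurableType d) (m : {measure set T -> \bar R})
    (f : T -> \bar R) (c : R) : m setT = 1 -> ge0mfun f ->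
  \int[m]_x f x <= c%:E -> exists x, f x <= c%:E.
Proof.
move=> m1 [f0 mf] fc; apply/not_existsP => cf.
have {}cf x : c%:E < f x by rewrite ltNge; apply/negP.
have c0 : (0 <= c)%R by rewrite -lee_fin (le_trans _ fc)//; exact: integral_ge0.
have mg : measurable_fun setT (fun x => f x - c%:E).
  by apply: emeasurable_funB => //; exact: measurable_cst.
have g0 x : 0 <= f x - c%:E by rewrite sube_ge0// ltW.
have : \int[m]_x (f x - c%:E) = 0.
  apply/eqP; rewrite eq_le integral_ge0// andbT.
  have fE : \int[m]_x f x = c%:E + \int[m]_x (f x - c%:E).
    transitivity (\int[m]_x (c%:E + (f x - c%:E))).
      by apply: eq_integral => x _; rewrite addeC subeK.
    by rewrite ge0_integralD// integral_cst// [m setT]m1 mule1.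
  by move: fc; rewrite fE -[leRHS]adde0 leeD2lE.
move=> int0.
have : \int[m]_x `|f x - c%:E| = 0.
  by rewrite -[RHS]int0; apply: eq_integral => x _; rewrite gee0_abs.
move/(ae_eq_integral_abs _ measurableT mg) => [N [mN N0 NT]].
suff NTT : N = setT by have := m1; rewrite -NTT N0 => /eqP; rewrite eqe eq_sym oner_eq0.
apply/seteqP; split=> // x _; apply: NT => /= /(_ I) gx0.
by have := cf x; rewrite -sube_gt0 gx0 ltxx.
Qed.

(* The trajectory is built one coordinate at a time, keeping all the conditional
   contents of the cylinders below the bound. *)
Lemma cyl_content_lt1 (F : (set Omega)^nat) (c : R) : (c < 1)%R ->
  (forall n, cylinder (F n)) -> (forall m n, (m <= n)%N -> F m `<=` F n) ->
  (forall n, cyl_content (F n) <= c%:E) -> \bigcup_n F n <> setT.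
Proof.
move=> c1 cF ndF Fc.
have [N FN] := choice (fun n => (cF n).2).
have mF n : measurable (F n) := (cF n).1.
pose f n (w : Omega) := (\1_(F n) w)%:E : \bar R.
have fN n : depends_below (N n) (f n) by exact: depends_below_indic.
have mf n : ge0mfun (f n) by exact: ge0mfun_indic.
pose h m n := steps (N n) m (f n).
have mh m n : ge0mfun (h m n) by exact: ge0mfun_steps.
(* [N n] steps are enough from any starting time, so one more is harmless. *)
have hS m n : h m n = step m (h m.+1 n).
  rewrite /h -[RHS]/(steps (N n).+1 m (f n)).
  by apply: (steps_stable (fN n)); rewrite ?leq_addl// addnS leqW// leq_addl.
have ndf w : nondecreasing_seq (f ^~ w).
  move=> a b ab; rewrite lee_fin !indicE ler_nat.
  have [/[!inE] Faw|//] := boolP (w \in F a).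
  by rewrite mem_set//; exact: ndF Faw.
have ndh m w : nondecreasing_seq (h m ^~ w).
  move=> a b ab; rewrite /h.
  pose j := maxn (N a) (N b).
  rewrite (@steps_stable (N a) m _ j _ (fN a)) ?leq_addl//; last first.
    by rewrite (leq_trans (leq_maxl (N a) (N b)))// leq_addl.
  rewrite (@steps_stable (N b) m _ j _ (fN b)) ?leq_addl//; last first.
    by rewrite (leq_trans (leq_maxr (N a) (N b)))// leq_addl.
  apply: (pfunctional_le (positive_functional_steps _ _ _)) => // x.
  exact: ndf.
pose good m w := forall n, h m n w <= c%:E.
have /choice[y yP] : forall mw : nat * Omega, exists y,
    good mw.1 mw.2 -> good mw.1.+1 (update mw.1 mw.2 y).
  move=> [m w]/=; have [gm|] := pselect (good m w); last by exists point.
  pose g n y := h m.+1 n (update m w y).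
  have mg n : ge0mfun (g n) := ge0mfun_comp (measurable_update2 m w) (mh m.+1 n).
  have cg y : cvgn (g ^~ y).
    by apply: ereal_nondecreasing_is_cvgn => a b ab; exact: ndh.
  (* One coordinate has to serve all [n] at once: monotone convergence bounds the integral of the
     supremum [u] by [c], and a point where [u] is at most [c] is good for every [n]. *)
  pose u y := limn (g ^~ y).
  have mu : ge0mfun u.
    split=> [x|]; first by apply: lime_ge => //; apply: nearW => n; case: (mg n).
    apply: (@emeasurable_fun_cvg _ _ _ _ (fun n => g n)) => [n|x _].
      by case: (mg n).
    exact: cg.
  have : \int[k m w]_y u y <= c%:E.
    have := pfunctional_cvg (positive_functional_integral (k m w)) mg _ cg.
    move=> /(_ (fun y => _)) cgu.
    rewrite -(cvg_lim _ (cgu _)) //; last by move=> x a b ab; exact: ndh.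
    apply: lime_le; first by apply/cvg_ex; eexists; apply: cgu => x a b ab; exact: ndh.
    by apply: nearW => n; have := gm n; rewrite hS.
  move/(exists_le_integral (prob_kernel w) mu) => [z uz].
  exists z => _ n; apply: le_trans uz.
  by apply: lime_ge => //; exists n => // p /= np; exact: ndh.
pose fix W (n : nat) : Omega :=
  if n is m.+1 then update m (W m) (y (m, W m)) else base.
have gW n : good n (W n).
  elim: n => [p|n IH]; last exact: (yP (n, W n)).
  by have := Fc p; rewrite (cyl_contentE (FN p)).
(* The diagonal trajectory: coordinate [i] is never changed after stage [i + 1]. *)
pose w : Omega := fun i => W i.+1 i.
have Ww n i : (i < n)%N -> W n i = w i.
  elim: n => // n IH; rewrite ltnS leq_eqVlt => /predU1P[->//|i_n].
  by rewrite /= update_lt// IH.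
move=> /seteqP[_ /(_ w I)[n _ Fnw]].
(* After [N n] stages the membership of [w] in [F n] is decided, so the conditional content is the
   indicator itself, here 1, against the bound [c < 1]. *)
have := gW (N n) n; rewrite /h steps_id//.
rewrite (fN n _ w); last exact: Ww.
by rewrite /f indicE mem_set// leNgt lte_fin c1.
Qed.

Let cyl_content_le1 B : cylinder B -> cyl_content B <= 1.
Proof.
move=> cB; rewrite -cyl_content_setT; apply: le_measure => //.
- by rewrite inE.
- by rewrite inE; exact: measurableT.
Qed.

Lemma cyl_content_cvg1 (F : (set cylinder_type)^nat) :
  (forall n, measurable (F n)) -> {homo F : m n / (m <= n)%N >-> m `<=` n} ->
  \bigcup_n F n = setT -> cyl_content (F n) @[n --> \oo] --> 1.
Proof.
move=> cF ndF FT.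
have ndc : nondecreasing_seq (fun n => cyl_content (F n)).
  by move=> m n mn; apply: le_measure => //; rewrite ?inE//; exact: ndF.
have cvgF := ereal_nondecreasing_is_cvgn ndc.
suff <- : limn (fun n => cyl_content (F n)) = 1 by [].
have l1 : limn (fun n => cyl_content (F n)) <= 1.
  by apply: lime_le => //; apply: nearW => n; exact: (cyl_content_le1 (cF n)).
apply/eqP; rewrite eq_le l1/= leNgt; apply/negP => llt1.
have l0 : 0 <= limn (fun n => cyl_content (F n)).
  by apply: lime_ge => //; exact: nearW.
have lfin : limn (fun n => cyl_content (F n)) \is a fin_num.
  by rewrite ge0_fin_numE// (le_lt_trans l1)// ltry.
apply: (@cyl_content_lt1 F (fine (limn (fun n => cyl_content (F n))))) => //.
- by rewrite -lte_fin fineK.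
- move=> n; rewrite fineK//.
  by apply: lime_ge => //; exists n => // p /= np; exact: ndc.
Qed.

Let cyl_content_sigma_additive : semi_sigma_additive cyl_content.
Proof.
move=> F mF tF mUF.
(* Adding the complement of the union, itself a cylinder, makes the partial unions increase to the
   whole space, the only case of continuity proved so far. *)
pose H n : set cylinder_type := \big[setU/set0]_(i < n) F i `|` ~` \bigcup_n F n.
have mU n : measurable (\big[setU/set0]_(i < n) F i) by exact: bigsetU_measurable.
have mH n : measurable (H n) by apply: measurableU => //; exact: measurableC.
have HE n : cyl_content (H n) =
    \sum_(0 <= i < n) cyl_content (F i) + cyl_content (~` \bigcup_n F n).
  rewrite /H measureU//; [|exact: measurableC|].
    by rewrite measure_semi_additive// big_mkord.
  apply/seteqP; split=> // x [+ nFx]; rewrite -bigcup_mkord => -[i _ Fi].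
  by apply: nFx; exists i.
have cH : cyl_content (H n) @[n --> \oo] --> 1.
  apply: cyl_content_cvg1 => //.
    move=> m n mn; apply: setSU; rewrite -!bigcup_mkord => x [i /= im Fi].
    by exists i => //=; exact: leq_trans mn.
  rewrite -subTset => x _; have [[i _ Fi]|nFx] := pselect ((\bigcup_n F n) x).
    by exists i.+1 => //; left; rewrite -bigcup_mkord; exists i => /=.
  by exists 0%N => //; right.
have cfin B : measurable B -> cyl_content B \is a fin_num.
  by move=> mB; rewrite ge0_fin_numE// (le_lt_trans (cyl_content_le1 mB))// ltry.
have mC : measurable (~` \bigcup_n F n) by exact: measurableC.
have -> : cyl_content (\bigcup_n F n) = 1 - cyl_content (~` \bigcup_n F n).
  rewrite -cyl_content_setT -(setUv (\bigcup_n F n)) measureU//; last exact: setICr.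
  by rewrite addeK// cfin.
rewrite (_ : (fun n => _) =
    (fun n => cyl_content (H n) - cyl_content (~` \bigcup_n F n))); last first.
  by apply/funext => n; rewrite HE addeK// cfin.
apply: cvgeB => //.
exact: cvg_cst.
Qed.

HB.instance Definition _ := Content_isMeasure.Build _ _ _ cyl_content
  cyl_content_sigma_additive.

Theorem ionescu_tulcea : exists P : probability Omega R,
  forall n f, ge0mfun f -> depends_below n.+1 f ->
    \int[P]_w f w = \int[P]_w \int[k n w]_y f (update n w y).
Proof.
pose m := measure_extension cyl_content.
(* The extension lives on the sigma-algebra generated by the cylinders; the identity transports it
   to the one of trajectories. *)
have mid : measurable_fun setT
    (id : g_sigma_algebraType (@measurable _ cylinder_type) -> Omega).
  apply: measurable_into_trajectory => n _ B mB; rewrite setTI.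
  apply: sub_sigma_algebra; split.
    by have := @measurable_coord n measurableT _ mB; rewrite setTI.
  by exists n.+1 => w w' ww'; rewrite /preimage/= ww'.
pose P0 := image_measure mid m.
have P0E B : cylinder B -> P0 B = cyl_content B.
  by move=> cB; exact: measurable_mu_extE.
have P01 : P0 setT = 1.
  by rewrite (P0E _ (@measurableT _ cylinder_type)) cyl_content_setT.
pose P := probability_of P01.
exists P => n f mf fn.
have PE j g : ge0mfun g -> depends_below j g -> \int[P]_w g w = steps j 0 g base.
  move=> mg gj.
  (* Freezing the coordinates from [j] on leaves [g] unchanged and turns the preimage of every
     measurable set into a cylinder, where [P] is known. *)
  pose r (w : Omega) : Omega := fun i => if (i < j)%N then w i else base i.
  have mr : measurable_fun setT r.
    apply: measurable_into_trajectory => i; rewrite /r; case: (i < j)%N.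
      exact: measurable_coord.
    exact: measurable_cst.
  have rj w i : (i < j)%N -> r w i = w i by rewrite /r => ->.
  have gr w : g (r w) = g w by apply: gj => i; exact: rj.
  transitivity (\int[image_measure mr P]_w g w).
    by rewrite integral_image_measure//; apply: eq_integral => w _; rewrite gr.
  apply/esym; rewrite -(_ : g \o r = g); last exact/funext.
  rewrite (_ : (fun w => (g \o r) w) = g); last exact/funext.
  apply: (@positive_functionalE _ _ _ (image_measure mr P)
    (fun g => steps j 0 (g \o r) base)) => //.
    exact: (positive_functional_precomp mr (positive_functional_steps _ _ _)).
  move=> U mU; rewrite image_measureE.
  have rU : depends_below j (r @^-1` U).
    move=> w w' ww'; rewrite /preimage/=; congr U; apply/funext => i.
    by rewrite /r; case: ifPn => // /ww'.
  have mrU : measurable (r @^-1` U) by rewrite -[X in measurable X]setTI; exact: mr.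
  rewrite [RHS]P0E; last by split => //; exists j.
  by rewrite (cyl_contentE rU).
rewrite (PE n.+1)// stepsSr add0n -(PE n)//.
  exact: ge0mfun_step.
exact: depends_below_step.
Qed.

End ionescu_tulcea.

(** * Disintegration over a compact Borel space *)

Section kernel_of_measures.
Context d1 d2 (X : measurableType d1) (Y : measurableType d2) (R : realType).
Context (m : X -> {measure set Y -> \bar R}).
Hypothesis mm : forall U, measurable U -> measurable_fun setT (m ^~ U).
Hypothesis m1 : forall x, m x setT = 1%E.

Let m_kernel := isKernel.Build _ _ _ _ _ m mm.
Let m_ker : R.-ker X ~> Y := HB.pack m m_kernel.
Let m_prob := Kernel_isProbability.Build _ _ _ _ _ m_ker m1.

Definition pker_of : R.-pker X ~> Y := HB.pack_for (R.-pker X ~> Y)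
  (Kernel.sort m_ker) m_prob.

Lemma pker_ofE x : pker_of x = m x. Proof. by []. Qed.

End kernel_of_measures.

(** * Bit sequences and the pi-system of their cylinders *)

Section bit_sequences.
Implicit Types (c : nat -> bool) (w : seq bool).

(** The latest bit comes first, so that lengthening a prefix is a [cons] and refining a cylinder is
    structural recursion on words. *)
Fixpoint prefix_rev n c : seq bool :=
  if n is m.+1 then c m :: prefix_rev m c else [::].

Lemma size_prefix_rev n c : size (prefix_rev n c) = n.
Proof. by elim: n => //= n ->. Qed.

Lemma prefix_revW m n c c' : (m <= n)%N ->
  prefix_rev n c = prefix_rev n c' -> prefix_rev m c = prefix_rev m c'.
Proof.
elim: n => [|n IH]; first by rewrite leqn0 => /eqP ->.
by rewrite leq_eqVlt => /predU1P[-> //|]; rewrite ltnS => mn [_ /IH]; apply.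
Qed.

Definition bit_cylinder w : set (nat -> bool) :=
  [set c | prefix_rev (size w) c = w].

(** Two cylinders are nested or disjoint; adding the empty set makes them a pi-system. *)
Definition bit_cylinders : set (set (nat -> bool)) :=
  [set E | E = set0 \/ exists w, E = bit_cylinder w].

Lemma bit_cylindersI : setI_closed bit_cylinders.
Proof.
move=> B C [->|[w ->]]; first by rewrite set0I; left.
move=> [->|[w' ->]]; first by rewrite setI0; left.
have H v v' : (size v <= size v')%N ->
    bit_cylinders (bit_cylinder v `&` bit_cylinder v').
  move=> vv'.
  have [[c [/= cv cv']]|nE] := pselect ((bit_cylinder v `&` bit_cylinder v') !=set0).
    right; exists v'; apply/seteqP; split=> [_ []//|c' c'v']; split => //=.
    by rewrite /bit_cylinder/= -[RHS]cv; apply: (prefix_revW vv'); rewrite cv'.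
  left; apply/seteqP; split=> // c cvv'; apply: nE; by exists c.
by have [/H//|/ltnW/H] := leqP (size w) (size w'); rewrite setIC.
Qed.

Definition bit_space := g_sigma_algebraType bit_cylinders.

Lemma measurable_bit_cylinder w : measurable (bit_cylinder w : set bit_space).
Proof. by apply: sub_sigma_algebra; right; exists w. Qed.

Lemma measurable_into_bits d (Z : measurableType d) (f : Z -> bit_space) :
  (forall w, measurable (f @^-1` bit_cylinder w)) -> measurable_fun setT f.
Proof.
move=> mf; apply: (@measurability _ _ _ bit_space setT f bit_cylinders) => //.
move=> _ [_ [->|[w ->]] <-]; rewrite setTI; last exact: mf.
by rewrite preimage_set0.
Qed.

Lemma bit_measure_eq (R : realType) (m1 m2 : {measure set bit_space -> \bar R}) :
  (m1 setT < +oo)%E -> (forall w, m1 (bit_cylinder w) = m2 (bit_cylinder w)) ->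
  forall E, measurable E -> m1 E = m2 E.
Proof.
move=> m1oo m12 E mE.
have bT : bit_cylinder [::] = setT by apply/seteqP; split.
apply: (@measure_unique _ R bit_space bit_cylinders (fun=> setT)) => //.
- exact: bit_cylindersI.
- by move=> _; right; exists [::].
- by rewrite bigcup_const//; exists 0%N.
- by move=> _ [->|[w ->]]; rewrite ?measure0.
Qed.

End bit_sequences.

(** * Disintegration over bit sequences by quantile functions *)

Section bit_disintegration.
Local Open Scope ereal_scope.
Context dX (X : measurableType dX) (R : realType).
Variable nu : {finite_measure set (X * bit_space)%type -> \bar R}.

Local Notation marg := (image_measure measurable_fst nu).

(** One Radon-Nikodym derivative per word: [f w x] is to be the conditional probability, given the
    state [x], that the bits begin with [w]. *)
Lemma bit_densities : exists f : seq bool -> X -> R,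
  forall w, [/\ forall x, (0 <= f w x)%R, measurable_fun setT (f w) &
    forall B, measurable B ->
      nu (B `*` bit_cylinder w) = \int[marg]_(x in B) (f w x)%:E].
Proof.
suff /choice : forall w, exists f : X -> R, [/\ forall x, (0 <= f x)%R,
    measurable_fun setT f & forall B, measurable B ->
      nu (B `*` bit_cylinder w) = \int[marg]_(x in B) (f x)%:E].
  by move=> [f fP]; exists f.
move=> w.
have marg_fin : fin_num_fun marg.
  move=> B mB; rewrite image_measureE fin_num_measure//.
  by rewrite -[X in measurable X]setTI; exact: measurable_fst.
pose margf := finite_measure_of marg_fin.
have mw := measurable_bit_cylinder w.
pose nuw := image_measure measurable_fst (mrestr nu (measurableX measurableT mw)).
have nuwE B : nuw B = nu (B `*` bit_cylinder w).
  rewrite /nuw image_measureE /= /mrestr; congr (nu _).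
  by apply/seteqP; split => -[x c]/=; [move=> [? []]|move=> []].
have nuw_fin : fin_num_fun nuw.
  by move=> B mB; rewrite nuwE fin_num_measure//; exact: measurableX.
pose nuwf := finite_measure_of nuw_fin.
have dom : nuwf `<< margf.
  apply/null_content_dominatesP => B mB /= B0.
  apply/eqP; rewrite -measure_le0 -B0 [leLHS]nuwE (image_measureE measurable_fst).
  apply: le_measure; rewrite ?inE//; first exact: measurableX.
    by rewrite -[X in measurable X]setTI; exact: measurable_fst.
  by move=> [x c] [].
have [g [g0 gfin /measurable_int mg gE]] := radon_nikodym_sigma_finite dom.
exists (fine \o g); split => [x||B mB].
- by rewrite fine_ge0.
- exact: measurableT_comp.
- rewrite -nuwE [LHS]gE//; apply: eq_integral => x _.
  by rewrite /= fineK.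
Qed.

Section quantile.
Variable f : seq bool -> X -> R.
Hypothesis f0 : forall w x, (0 <= f w x)%R.
Hypothesis mf : forall w, measurable_fun setT (f w).
Hypothesis fE : forall w B, measurable B ->
  nu (B `*` bit_cylinder w) = \int[marg]_(x in B) (f w x)%:E.

(** Left end of the interval attached to a word. That interval is cut into those of the two one-bit
    extensions, the one by [false] on the left. *)
Fixpoint left_end (w : seq bool) (x : X) : R :=
  if w is b :: v then
    (left_end v x + (if b then f (false :: v) x else 0))%R
  else 0%R.

(* The n-th bit tells in which part of the current interval [u] lies; the
   interval attached to [w] has length [f w x]. *)
Fixpoint quantile_prefix n (xu : X * R) : seq bool :=
  if n is m.+1 then
    let w := quantile_prefix m xu in
    (left_end w xu.1 + f (false :: w) xu.1 <= xu.2)%R :: w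
  else [::].

(** An inverse distribution function with parameter [x]. The image of Lebesgue measure is a
    probability for every [x], even where the densities are inconsistent, so no exceptional set has
    to be repaired. *)
Definition quantile (xu : X * R) : bit_space := fun n =>
  let w := quantile_prefix n xu in
  (left_end w xu.1 + f (false :: w) xu.1 <= xu.2)%R.

Lemma prefix_quantile n xu : prefix_rev n (quantile xu) = quantile_prefix n xu.
Proof. by elim: n => //= n ->. Qed.

Lemma measurable_left_end w : measurable_fun setT (left_end w).
Proof.
elim: w => [|b v IH] /=; first exact: measurable_cst.
by apply: measurable_funD => //; case: b => //; exact: measurable_cst.
Qed.

Lemma measurable_quantile : measurable_fun setT quantile.
Proof.
apply: measurable_into_bits => w.
rewrite (_ : _ @^-1` _ = [set xu | quantile_prefix (size w) xu = w]); last first.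
  by apply/seteqP; split => xu; rewrite /preimage /bit_cylinder /= prefix_quantile.
elim: w => [|b w IH] /=.
  by rewrite (_ : [set _ | _] = setT)//; apply/seteqP; split.
have mt : measurable [set xu : X * R |
    (left_end w xu.1 + f (false :: w) xu.1 <= xu.2)%R].
  rewrite -[X in measurable X]setTI; apply: measurable_fun_le => //.
  apply: measurable_funD; apply: measurableT_comp => //.
  exact: measurable_left_end.
rewrite (_ : [set _ | _] = [set xu | quantile_prefix (size w) xu = w] `&`
  (if b then [set xu : X * R | (left_end w xu.1 + f (false :: w) xu.1 <= xu.2)%R]
   else ~` [set xu : X * R | (left_end w xu.1 + f (false :: w) xu.1 <= xu.2)%R])).
  by apply: measurableI => //; case: b => //; exact: measurableC.
apply/seteqP; split => xu /=.
  by case=> + qw; rewrite qw => <-; split => //; case: ifPn => // /negP.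
by move=> [qw]; rewrite qw; case: b => [->|/negP/negPf ->].
Qed.

Definition unit_lebesgue : {measure set (measurableTypeR R) -> \bar R} :=
  mrestr (@lebesgue_measure R) (measurable_itv `[0%R, 1%R[).

Lemma unit_lebesgue_setT : unit_lebesgue setT = 1.
Proof.
by rewrite /unit_lebesgue /= /mrestr setTI lebesgue_measure_itv/= lte01 oppr0 adde0.
Qed.

Let good x := f [::] x = 1%R /\
  forall w, f w x = (f (false :: w) x + f (true :: w) x)%R.

(** Where the densities are consistent, the half-open intervals of the words of a given length
    partition the unit interval, and the prefix names the one that contains [u]. *)
Lemma quantile_prefixP x w (u : R) : good x -> (0 <= u < 1)%R ->
  quantile_prefix (size w) (x, u) = w <->
  (left_end w x <= u < left_end w x + f w x)%R.
Proof.
move=> [f1 fD] u01; elim: w => [|b w IH] /=; first by rewrite f1 add0r.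
have := fD w; have := f0 (false :: w) x; have := f0 (true :: w) x.
move=> ft0 ff0 fw.
split.
- case=> + qw; rewrite qw; have /IH/andP[lu ul] := qw.
  by case: b => [lfu|/negbT]; rewrite -?ltNge; lra.
- case: b => /andP[lu ul].
    have qw : quantile_prefix (size w) (x, u) = w by apply/IH; lra.
    by rewrite qw; congr (_ :: _); lra.
  have qw : quantile_prefix (size w) (x, u) = w by apply/IH; lra.
  by rewrite qw; congr (_ :: _); apply/negP; lra.
Qed.

Lemma unit_lebesgue_quantile x w : good x ->
  unit_lebesgue [set u : R | bit_cylinder w (quantile (x, u))] = (f w x)%:E.
Proof.
move=> gx; rewrite /unit_lebesgue/= /mrestr.
rewrite (_ : _ `&` _ =
    `[left_end w x, (left_end w x + f w x)%R[%classic); last first.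
  have in01 : (0 <= left_end w x /\ left_end w x + f w x <= 1)%R.
    case: gx => f1 fD; elim: w => [|b w [IH1 IH2]] /=; first by rewrite f1 add0r.
    have := fD w; have := f0 (false :: w) x; have := f0 (true :: w) x.
    by case: b => *; split; lra.
  apply/seteqP; split => u /=; rewrite !in_itv/=.
    move=> [+ u01]; rewrite /bit_cylinder /= prefix_quantile.
    by move/(quantile_prefixP _ gx u01).
  move=> uw; have u01 : (0 <= u < 1)%R by case/andP: uw; lra.
  split=> //; rewrite /bit_cylinder /= prefix_quantile.
  exact/(quantile_prefixP _ gx u01).
rewrite lebesgue_measure_itv/= lte_fin ltrDl.
have := f0 w x; rewrite le_eqVlt => /predU1P[<-|->]; first by rewrite ltxx.
by rewrite -EFinD addrAC subrr add0r.
Qed.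

End quantile.

Lemma bit_disintegration : exists k : R.-pker X ~> bit_space,
  forall B E, measurable B -> measurable E ->
    nu (B `*` E) = \int[marg]_(x in B) k x E.
Proof.
have [f fP] := bit_densities.
have f0 w x : (0 <= f w x)%R by case: (fP w).
have mf w : measurable_fun setT (f w) by case: (fP w).
have fE w B : measurable B ->
    nu (B `*` bit_cylinder w) = \int[marg]_(x in B) (f w x)%:E.
  by case: (fP w) => _ _ h /h.
have mfE w : measurable_fun setT (EFin \o f w) by exact/measurable_EFinP.
pose q := quantile f; have mq : measurable_fun setT q := measurable_quantile mf.
have mq2 x : measurable_fun setT (fun u : measurableTypeR R => q (x, u)).
  exact: measurable_fun_pair2 mq.
pose lam := probability_of unit_lebesgue_setT.
pose k0 x := image_measure (mq2 x) lam.
have mk0 U : measurable U -> measurable_fun setT (k0 ^~ U).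
  move=> mU; have mqU : measurable (q @^-1` U).
    by rewrite -[X in measurable X]setTI; exact: mq.
  rewrite (_ : k0 ^~ U = lam \o xsection (q @^-1` U)).
    exact: measurable_fun_xsection.
  apply/funext => x; rewrite /k0 image_measureE /=; congr (lam _).
  by rewrite xsectionE.
have k01 x : k0 x setT = 1 by exact: (probability_setT lam).
exists (pker_of mk0 k01) => B E mB mE.
have fint w : marg.-integrable setT (EFin \o f w).
  apply/integrableP; split => //.
  rewrite (eq_integral (EFin \o f w)) => [|x _]; last by rewrite /= (ger0_norm (f0 w x)).
  rewrite -(fE w setT)//; rewrite ltey_eq fin_num_measure//.
  by apply: measurableX => //; exact: measurable_bit_cylinder.
(* The cylinder of the empty word is the whole space, so its density is that of the marginal with
   respect to itself. *)
have f1 : {ae marg, forall x, f [::] x = 1%R}.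
  have : ae_eq marg setT (EFin \o f [::]) (cst 1).
    apply: integral_ae_eq => // C _ mC.
    rewrite -fE// integral_cst// mul1e image_measureE; congr (nu _).
    by apply/seteqP; split => -[x c] //= [].
  by apply: filterS => x /(_ I) [].
have fD : {ae marg, forall x, forall w,
    f w x = (f (false :: w) x + f (true :: w) x)%R}.
  have fDw w : {ae marg, forall x,
      f w x = (f (false :: w) x + f (true :: w) x)%R}.
    have : ae_eq marg setT (EFin \o f w)
        (fun x => (f (false :: w) x)%:E + (f (true :: w) x)%:E).
      apply: integral_ae_eq => // [|C _ mC]; first exact: emeasurable_funD (mfE _) (mfE _).
      rewrite ge0_integralD//; last 4 first.
      - by move=> x _; rewrite lee_fin.
      - exact: measurable_funTS (mfE _).
      - by move=> x _; rewrite lee_fin.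
      - exact: measurable_funTS (mfE _).
      rewrite -!fE// -measureU//; last 3 first.
      - by apply: measurableX => //; exact: measurable_bit_cylinder.
      - by apply: measurableX => //; exact: measurable_bit_cylinder.
      - by apply/seteqP; split => // -[x c] [[_ /= [cf _]] [_ /= []]]; rewrite cf.
      congr (nu _); apply/seteqP; split => -[x c]; rewrite /bit_cylinder /=.
        by move=> [Cx cw]; rewrite cw; case: (c (size w)); [right|left].
      by move=> [[Cx [_ cw]]|[Cx [_ cw]]].
    by apply: filterS => x /(_ I) /= [].
  (* Words are countable: enumerating them by [unpickle] merges their exceptional sets into one null
     set. *)
  have /ae_foralln : forall n, {ae marg, forall x, forall w,
      (unpickle n : option (seq bool)) = Some w ->
      f w x = (f (false :: w) x + f (true :: w) x)%R}.
    move=> n; case nw : (unpickle n : option (seq bool)) => [w|]; last first.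
      exact: nearW.
    by apply: filterS (fDw w) => x fw v [<-].
  by apply: filterS => x h w; exact: h (pickleK w).
have kf w : {ae marg, forall x, pker_of mk0 k01 x (bit_cylinder w) = (f w x)%:E}.
  move: f1 fD; apply: filterS2 => x fx1 fxD.
  by rewrite pker_ofE -(unit_lebesgue_quantile f0 w (conj fx1 fxD)).
(* With [B] frozen, both sides are finite measures in [E], and it is enough to compare them on
   cylinders. *)
pose m1 := image_measure measurable_snd (mrestr nu (measurableX mB measurableT)).
have m1E C : m1 C = nu (B `*` C).
  rewrite /m1 image_measureE /= /mrestr; congr (nu _).
  by apply/seteqP; split => -[x c]/=; [move=> [? []]|move=> []].
rewrite -m1E -bind_measureE; apply: bit_measure_eq => //.
  by rewrite m1E ltey_eq fin_num_measure//; exact: measurableX.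
move=> w; rewrite m1E fE//; apply: ae_eq_integral => //.
- exact: measurable_funTS (mfE w).
- apply: measurable_funTS; apply: measurable_kernel; exact: measurable_bit_cylinder.
- by have := kf w; apply: filterS => x <-.
Qed.

End bit_disintegration.

HB.instance Definition _ (R : realType) (S : pointedType)
  (T : pseudoMetricType R) (f : S -> T) := Pointed.on (initial_topology f).

(** * Measurable retraction of the Cantor space onto a compact Borel space *)

Section cantor_retraction.
Context (R : realType) (A : ptopologicalType).
Hypotheses (bA : borel_space R A) (cA : compact [set: A]).

Lemma cantor_image : exists g : (nat -> bool) -> A,
  [/\ continuous (g : cantor_space -> A), hausdorff_space A &
    forall a, exists c, g c = a].
Proof.
have [S [f [hS _ finj fopen _]]] := bA.
(* [A] is only a topological space; the initial topology of the embedding supplies a metric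
   structure on the same points, and the identity is a homeomorphism. *)
pose T : pseudoPMetricType R := initial_topology f.
have AT : continuous (id : A -> T).
  by apply/continuousP => _ [V oV <-]; apply/fopen; exists V.
have TA : continuous (id : T -> A).
  by apply/continuousP => U /fopen[V oV ->]; exists V.
have cT : compact [set: T].
  rewrite (_ : [set: T] = (id : A -> T) @` [set: A]); last first.
    by apply/seteqP; split => // x _; exists x.
  apply: continuous_compact => //; exact: continuous_subspaceT.
have hA : hausdorff_space A.
  rewrite open_hausdorff => x y xy; move: hS; rewrite open_hausdorff => hS0.
  have fxy : f x != f y by apply: contra_neq xy; exact: finj.
  have [[U V] [/= fU fV] [oU oV UV]] := hS0 _ _ fxy.
  exists (f @^-1` U, f @^-1` V); first by move: fU fV; rewrite !inE.
  split => /=; [by apply/fopen; exists U|by apply/fopen; exists V|].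
  by rewrite -preimage_setI (eqP UV) preimage_set0.
have hT : hausdorff_space T.
  move=> x y xy; apply: hA => U V Ux Vy.
  by apply: xy; [exact: TA Ux|exact: TA Vy].
have [g cg] := cantor_surj cT hT.
exists g; split => //.
  move=> c U /TA gU; exact: (cg c _ gU).
by move=> a; have [c _ gc] := @surj _ _ _ _ g a I; exists c.
Qed.

Lemma open_bit_cylinder w : open (bit_cylinder w : set cantor_space).
Proof.
elim: w => [|b w IH].
  rewrite (_ : bit_cylinder [::] = setT); first exact: openT.
  by apply/seteqP; split.
rewrite (_ : bit_cylinder (b :: w) =
  bit_cylinder w `&` (fun c : cantor_space => c (size w)) @^-1` [set b]).
  apply: openI => //; apply: open_comp.
    by move=> c _; exact: (@proj_continuous nat (fun=> bool) (size w)).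
  exact: discrete_open.
by apply/seteqP; split=> c; rewrite /bit_cylinder /= => -[-> ->].
Qed.

(** The filter generated by the prefix cylinders of [c] converges to [c] in each coordinate, hence
    in the product topology. *)
Lemma open_bit_nbhs (O : set cantor_space) c : open O -> O c ->
  exists n, bit_cylinder (prefix_rev n c) `<=` O.
Proof.
move=> oO Oc.
pose F := filter_from [set: nat] (fun n => bit_cylinder (prefix_rev n c)).
have cylP n c' : bit_cylinder (prefix_rev n c) c' <->
    prefix_rev n c' = prefix_rev n c.
  by rewrite /bit_cylinder /= size_prefix_rev.
have FF : Filter F.
  apply: filter_from_filter; first by exists 0%N.
  move=> i j _ _; exists (maxn i j) => // c' /cylP c'c.
  by split; apply/cylP; apply: prefix_revW c'c; rewrite ?leq_maxl ?leq_maxr.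
have Fc : F --> (c : cantor_space).
  apply/cvg_sup => i U [V] [[W] oW <-] Wc WU.
  exists i.+1 => // c' /cylP [c'c _]; apply: WU.
  by rewrite /preimage /proj /= c'c.
have /Fc[n _ nO] : nbhs (c : cantor_space) O by exact: open_nbhs_nbhs.
by exists n.
Qed.

Lemma measurable_open_bits (O : set cantor_space) : open O ->
  measurable (O : set bit_space).
Proof.
move=> oO; rewrite (_ : O =
    \bigcup_(w in [set w | bit_cylinder w `<=` O]) bit_cylinder w).
  rewrite bigcup_mkcond; apply: countable_bigcupT_measurable => // w.
  case: ifP => // _; exact: measurable_bit_cylinder.
apply/seteqP; split=> [c Oc|c [w /= wO wc]]; last exact: wO.
have [n nO] := open_bit_nbhs oO Oc; exists (prefix_rev n c) => //.
by rewrite /bit_cylinder /= size_prefix_rev.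
Qed.

(* [s a] is the lexicographically least bit sequence that [g] maps to [a]; greedy
   choices make it measurable, the image of a cylinder being compact. *)
Lemma cantor_retract : exists (g : bit_space -> borel A) (s : borel A -> bit_space),
  [/\ measurable_fun setT g, measurable_fun setT s & forall a, g (s a) = a].
Proof.
have [g [cg hA gsurj]] := cantor_image.
have closed_img w : closed (g @` bit_cylinder w).
  apply: compact_closed => //.
  apply: (@continuous_compact cantor_space A g (bit_cylinder w)).
    exact: (@continuous_subspaceT cantor_space A _ g cg).
  apply: (@subclosed_compact _ _ [set: cantor_space]) => //.
    (* A cylinder is closed because its complement is the union of the other cylinders of the same
       length, which are open. *)
    have -> : bit_cylinder w = ~` \bigcup_(v in [set v | size v = size w /\ v <> w])
        bit_cylinder v.
      apply/seteqP; split=> c; rewrite /bit_cylinder /=.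
        by move=> cw [v /= [vw nvw]]; rewrite vw cw => /esym.
      move=> ncw; apply: contrapT => cw; apply: ncw.
      by exists (prefix_rev (size w) c); rewrite /= size_prefix_rev.
    apply: open_closedC; apply: bigcup_open => v _; exact: open_bit_cylinder.
  exact: cantor_space_compact.
have mimg w : measurable (g @` bit_cylinder w : set (borel A)).
  rewrite -[X in measurable X]setCK; apply: measurableC.
  by apply: sub_sigma_algebra; exact: closed_openC.
(* The bit [false] is taken whenever some point of the shorter cylinder extended by it is still
   mapped to [a]. *)
pose fix spre (n : nat) (a : A) {struct n} : seq bool :=
  if n is m.+1 then
    let w := spre m a in ~~ `[< (g @` bit_cylinder (false :: w)) a >] :: w
  else [::].
pose s (a : A) : nat -> bool := fun n =>
  ~~ `[< (g @` bit_cylinder (false :: spre n a)) a >].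
have pre_s n a : prefix_rev n (s a) = spre n a by elim: n => //= n ->.
have size_spre n a : size (spre n a) = n by rewrite -pre_s size_prefix_rev.
have spre_img n a : (g @` bit_cylinder (spre n a)) a.
  elim: n => [|n [c cw gc]] /=.
    by have [c gc] := gsurj a; exists c.
  have [//|/=] := asboolP ((g @` bit_cylinder (false :: spre n a)) a).
  move=> nf; exists c => //; move: cw nf.
  rewrite /bit_cylinder /= => cw nf; rewrite cw; congr (_ :: _).
  by apply: contrapT => /negP cf; apply: nf; exists c => //=; rewrite cw (negPf cf).
have ms : measurable_fun setT (s : borel A -> bit_space).
  apply: measurable_into_bits => w.
  rewrite (_ : _ @^-1` _ = [set a | spre (size w) a = w]); last first.
    by apply/seteqP; split => a; rewrite /preimage /bit_cylinder /= pre_s.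
  elim: w => [|b w IH] /=.
    by rewrite (_ : [set _ | _] = setT)//; apply/seteqP; split.
  rewrite (_ : [set _ | _] = [set a | spre (size w) a = w] `&`
    (if b then ~` (g @` bit_cylinder (false :: w))
     else g @` bit_cylinder (false :: w))).
    by apply: measurableI => //; case: b => //; exact: measurableC.
  apply/seteqP; split => a.
    move=> /= [+ aw]; rewrite aw => <-; split => //.
    by case: ifPn => [/asboolPn //|/negPn/asboolP].
  move=> /= [aw +]; rewrite aw; case: b => [/asboolPn ->//|/asboolP ->//].
exists g, s; split => // [|a].
  apply: (@measurability _ _ bit_space (borel A) setT g (@open A)) => //.
  move=> _ [V oV <-]; rewrite setTI; apply: measurable_open_bits.
  by apply: open_comp => // c _; exact: cg.
(* By continuity a whole prefix cylinder of [s a] would miss the value [a], yet by construction the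
   image of each of them contains it. *)
apply: contrapT => gsa.
have oO : open (g @^-1` (~` [set a]) : set cantor_space).
  apply: open_comp; first by move=> c _; exact: cg.
  by apply: closed_openC; apply: accessible_closed_set1; exact: hausdorff_accessible.
have [n nO] := open_bit_nbhs oO gsa.
have [c cw gc] := spre_img n a; apply: (nO c) => //.
by rewrite /bit_cylinder /= pre_s.
Qed.

End cantor_retraction.

Section disintegration.
Local Open Scope ereal_scope.
Context dX (X : measurableType dX) (R : realType) (A : ptopologicalType).

(** The measure is pushed to bits by the section [s], disintegrated there, and the kernel is pushed
    back by [g]; since [g] undoes [s], rectangles come back unchanged. *)
Theorem disintegration (nu : {finite_measure set (X * borel A)%type -> \bar R}) :
  borel_space R A -> compact [set: A] ->
  exists k : R.-pker X ~> borel A, forall B C, measurable B -> measurable C ->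
    nu (B `*` C) = \int[image_measure measurable_fst nu]_(x in B) k x C.
Proof.
move=> bA cA; have [g [s [mg ms gs]]] := cantor_retract bA cA.
pose h (z : X * borel A) := (z.1, s z.2).
have mh : measurable_fun setT h.
  apply: measurable_fun_pair => /=; first exact: measurable_fst.
  exact: measurableT_comp ms measurable_snd.
have hfin : fin_num_fun (image_measure mh nu).
  move=> B mB; rewrite image_measureE fin_num_measure//.
  by rewrite -[X in measurable X]setTI; exact: mh.
have [k kP] := bit_disintegration (finite_measure_of hfin).
pose k0 x := image_measure mg (k x).
have mk0 U : measurable U -> measurable_fun setT (k0 ^~ U).
  move=> mU; apply: measurable_kernel.
  by rewrite -[X in measurable X]setTI; exact: (mg measurableT).
have k01 x : k0 x setT = 1.
  by rewrite /k0 image_measureE preimage_setT prob_kernel.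
exists (pker_of mk0 k01) => B C mB mC.
have mgC : measurable (g @^-1` C).
  by rewrite -[X in measurable X]setTI; exact: (mg measurableT).
have := kP B _ mB mgC; rewrite [LHS](image_measureE mh).
rewrite (_ : h @^-1` (B `*` g @^-1` C) = B `*` C); last first.
  by apply/seteqP; split => -[x a]; rewrite /preimage /= gs.
by move=> ->; apply: eq_measure_integral => U mU _.
Qed.

End disintegration.

(** * Existence of strategic measures *)

Section kernel_constructions.
Local Open Scope ereal_scope.
Context d1 d2 (X : measurableType d1) (Y : measurableType d2) (R : realType).

Section comap.
Context d (Z : measurableType d) (h : Z -> X) (mh : measurable_fun setT h)
  (k : R.-pker X ~> Y).

Let mk U : measurable U -> measurable_fun setT (fun z => k (h z) U).
Proof.
move=> mU; apply: (measurableT_comp (measurable_kernel k U mU)); exact: mh.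
Qed.

Definition pker_comap : R.-pker Z ~> Y :=
  @pker_of _ _ Z Y R (fun z => k (h z)) mk (fun z => prob_kernel (h z)).

Lemma pker_comapE z : pker_comap z = k (h z). Proof. by []. Qed.

End comap.

Lemma measurable_section (x : X) : measurable_fun setT (fun y : Y => (x, y)).
Proof. exact: measurable_pair1. Qed.

Variable k : R.-pker X ~> Y.

Lemma ge0mfun_kernel_pair (f : X * Y -> \bar R) : ge0mfun f ->
  ge0mfun (fun x => \int[k x]_y f (x, y)).
Proof.
move=> [f0 mf]; split=> [x|]; first exact: integral_ge0.
exact: (measurable_fun_integral_finite_kernel f k).
Qed.

Definition graph_fun x := image_measure (measurable_section x) (k x).

Let mgraph U : measurable U -> measurable_fun setT (graph_fun ^~ U).
Proof.
move=> mU; rewrite (_ : graph_fun ^~ U = fun x => k x (xsection U x)).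
  by apply: measurable_fun_xsection_finite_kernel; rewrite inE.
by apply/funext => x; rewrite /graph_fun image_measureE xsectionE.
Qed.

Let graph1 x : graph_fun x setT = 1.
Proof. by rewrite /graph_fun image_measureE preimage_setT prob_kernel. Qed.

Definition graph_kernel : R.-pker X ~> (X * Y)%type := pker_of mgraph graph1.

Lemma integral_graph_kernel x f : ge0mfun f ->
  \int[graph_kernel x]_z f z = \int[k x]_y f (x, y).
Proof. by move=> mf; rewrite pker_ofE integral_image_measure. Qed.

End kernel_constructions.

Section conditional_laws.
Local Open Scope ereal_scope.
Context d (W : measurableType d) (R : realType) (P : probability W R).
Context d1 (T1 : measurableType d1) d2 (T2 : measurableType d2).
Variables (Y : W -> T1) (Z : W -> T2) (k : R.-pker T1 ~> T2).
Hypotheses (mY : measurable_fun setT Y) (mZ : measurable_fun setT Z).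

(** [conditional_law] speaks of rectangles only, but these determine the joint law of [Y] and [Z],
    which is therefore the law of [Y] followed by the graph kernel. *)
Lemma conditional_law_integral : conditional_law P Y Z (fun y => k y) ->
  forall f, ge0mfun f ->
    \int[P]_w f (Y w, Z w) = \int[P]_w \int[k (Y w)]_z f (Y w, z).
Proof.
move=> PYZ f mf.
have mYZ : measurable_fun setT (fun w => (Y w, Z w)).
  exact: measurable_fun_pair.
pose K := pker_comap mY (graph_kernel k).
rewrite -(integral_image_measure mYZ P mf).
rewrite (@integral_bind _ _ _ _ _ P K) //.
  by apply: eq_integral => w _; rewrite -(integral_graph_kernel k (Y w) mf).
move=> U mU; rewrite -(bind_measureE P K measurableT).
apply: measure_prod_eq => //.
  by rewrite image_measureE preimage_setT [X in (X < _)%E](@probability_setT _ _ _ P) ltry.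
move=> B C mB mC; rewrite image_measureE bind_measureE.
rewrite (_ : _ @^-1` _ = Y @^-1` B `&` Z @^-1` C); last first.
  by apply/seteqP; split.
rewrite [LHS](_ : _ = \int[P]_(w in Y @^-1` B) k (Y w) C); last exact: PYZ.
rewrite [LHS]integral_mkcond; apply: eq_integral => w _.
rewrite patchE -[RHS]/(k (Y w) ((fun z => (Y w, z)) @^-1` (B `*` C))).
case: ifPn => [/[!inE] YB|/negP nYB].
  by congr (k _ _); apply/seteqP; split => z //= [].
rewrite (_ : _ @^-1` _ = set0) ?measure0//; apply/seteqP; split => z //= [BY _].
by apply: nYB; rewrite inE.
Qed.

End conditional_laws.

Section histories.
Context dX (X : measurableType dX) dA (A : measurableType dA).

Lemma measurable_state_at n : measurable_fun setT (@state_at _ X _ A n).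
Proof. exact: (measurableT_comp measurable_fst (measurable_coord n)). Qed.

Lemma measurable_action_at n : measurable_fun setT (@action_at _ X _ A n).
Proof. exact: (measurableT_comp measurable_snd (measurable_coord n)). Qed.

Lemma measurable_history n : measurable_fun setT (@history _ X _ A n).
Proof.
elim: n => [|n IH]; first exact: measurable_state_at.
apply: measurable_fun_pair; last exact: measurable_state_at.
by apply: measurable_fun_pair => //; exact: measurable_action_at.
Qed.

Lemma measurable_hist_last n : measurable_fun setT (@hist_last _ X _ A n).
Proof. by case: n => [|n]; [exact: measurable_id|exact: measurable_snd]. Qed.

Lemma hist_last_history n (w : trajectory X A) : hist_last (history n w) = state_at n w.
Proof. by case: n. Qed.

Lemma depends_below_history n : depends_below n.+1 (@history _ X _ A n).
Proof.
elim: n => [|n IH] w w' ww'; first by rewrite /history /state_at ww'.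
rewrite /= (IH w w') => [|i i_n]; last exact/ww'/ltnW.
by rewrite /action_at /state_at !ww'.
Qed.

(** The history at time [n] when the current state is drawn but not yet written into the trajectory;
    the action at time [n] is chosen from it. *)
Definition next_history n (wx : trajectory X A * X) : hist X A n :=
  match n return hist X A n with
  | 0 => wx.2
  | m.+1 => (history m wx.1, action_at m wx.1, wx.2)
  end.

Lemma measurable_next_history n :
  measurable_fun [set: (trajectory X A * X)%type] (@next_history n).
Proof.
case: n => [|n]; first exact: measurable_snd.
apply: (@measurable_fun_pair _ _ _ _ _ _ (fun wx : trajectory X A * X =>
  (history n wx.1, action_at n wx.1)) snd); last exact: measurable_snd.
apply: (@measurable_fun_pair _ _ _ _ _ _ (@history _ X _ A n \o fst)
  (@action_at _ X _ A n \o fst)).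
  apply: (@measurableT_comp _ _ _ (trajectory X A * X)%type (trajectory X A)
    (hist X A n)); first exact: measurable_history.
  exact: measurable_fst.
apply: (@measurableT_comp _ _ _ (trajectory X A * X)%type (trajectory X A) A).
  exact: measurable_action_at.
exact: measurable_fst.
Qed.

Lemma history_update n (w : trajectory X A) x a : history n (update n w (x, a)) = next_history n (w, x).
Proof.
case: n => [|n] /=; first by rewrite /state_at /update eqxx.
rewrite /state_at /action_at {2 3}/update eqxx ltn_eqF//.
by congr (_, _, _); apply: depends_below_history => i i_n; rewrite update_lt.
Qed.

Lemma action_at_update n (w : trajectory X A) x a : action_at n (update n w (x, a)) = a.
Proof. by rewrite /action_at /update eqxx. Qed.

End histories.

Section kproduct_integral.
Local Open Scope ereal_scope.
Context d0 d1 d2 (Z : measurableType d0) (X : measurableType d1)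
  (Y : measurableType d2) (R : realType).
Variables (k1 : R.-pker Z ~> X) (k2 : R.-pker (Z * X)%type ~> Y).

Let prod1 z : mkproduct k1 k2 z setT = 1.
Proof.
rewrite /mkproduct /= /kproduct (eq_integral (cst 1)) => [|x _].
  by rewrite integral_cst//= [X in 1 * X](prob_kernel z) mule1.
rewrite /kernel.intker_indic (eq_integral (cst 1)) => [|y _].
  by rewrite integral_cst//= [X in 1 * X](prob_kernel (z, x)) mule1.
by rewrite indicT.
Qed.

Definition pker_product : R.-pker Z ~> (X * Y)%type :=
  pker_of (measurable_kernel (mkproduct k1 k2)) prod1.

Lemma integral_pker_product z f : ge0mfun f ->
  \int[pker_product z]_xy f xy = \int[k1 z]_x \int[k2 (z, x)]_y f (x, y).
Proof.
move=> mf; apply/esym; move: f mf.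
apply: (@positive_functionalE _ _ _ (pker_product z)
  (fun f => \int[k1 z]_x \int[k2 (z, x)]_y f (x, y))); last first.
  by move=> U mU.
pose k2z := pker_comap (@measurable_section _ _ Z X z) k2.
apply: (@positive_functional_comp _ _ _ _ _ _
  (fun f x => \int[k2 (z, x)]_y f (x, y))).
- exact: positive_functional_integral.
- by move=> f mf; exact: (ge0mfun_kernel_pair k2z).
- move=> x; exact: (positive_functional_precomp (@measurable_section _ _ X Y x)
    (positive_functional_integral (k2 (z, x)))).
Qed.

End kproduct_integral.

Lemma integral_pker_cst d1 d2 (X : measurableType d1) (Y : measurableType d2)
    (R : realType) (k : R.-pker X ~> Y) (x : X) (c : \bar R) :
  (\int[k x]_y c = c)%E.
Proof. by rewrite integral_cst//= [X in (_ * X)%E](prob_kernel x) mule1. Qed.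

Lemma integral_setX d1 d2 (X : measurableType d1) (Y : measurableType d2)
    (R : realType) (m : {measure set Y -> \bar R}) (x : X) (B : set X) (C : set Y) :
  measurable C ->
  (\int[m]_y (\1_(B `*` C) (x, y))%:E = (\1_B x)%:E * m C)%E.
Proof.
move=> mC; transitivity (\int[m]_y ((\1_B x)%:E * (\1_C y)%:E))%E.
  apply: eq_integral => y _; rewrite -EFinM !indicE; congr (_%:E).
  by rewrite -natrM mulnb in_setX.
have mC1 := @ge0mfun_indic _ _ R _ mC.
have := pfunctionalZ (positive_functional_integral m) _ mC1.
move=> /(_ (\1_B x)) -> //.
by rewrite integral_indic// setIT.
Qed.

Section strategic_measures.
Local Open Scope ereal_scope.
Context (R : realType) dX (X : measurableType dX) (A : ptopologicalType)
  (dim : nat) (M : control_model R X A dim).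
Local Notation Omega := (trajectory X (borel A)).

Section existence.
Variable pi : policy M.

Definition state_kernel (n : nat) : R.-pker Omega ~> X :=
  if n is m.+1 then pker_comap (measurable_coord m) (transition M)
  else pker_of (fun U mU => measurable_cst (initial M U))
    (fun _ : Omega => @probability_setT _ _ _ (initial M)).

Lemma state_kernel0 w :
  state_kernel 0 w = initial M :> {measure set X -> \bar R}.
Proof. by []. Qed.

Lemma state_kernelS n w :
  state_kernel n.+1 w = transition M (w n) :> {measure set X -> \bar R}.
Proof. by []. Qed.

Definition action_kernel (n : nat) : R.-pker (Omega * X)%type ~> borel A :=
  pker_comap (@measurable_next_history _ X _ (borel A) n) (pi n).

(** A coordinate is a state-action pair: the state is drawn from the previous pair, then the action
    from the history that includes this state. *)
Definition coord_kernel n : R.-pker Omega ~> (X * borel A)%type :=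
  pker_product (state_kernel n) (action_kernel n).

Lemma depends_below_coord_kernel n : depends_below n (fun w => coord_kernel n w).
Proof.
move=> w w' ww'; apply: eq_measure; apply/funext => U.
have nww' x : next_history n (w, x) = next_history n (w', x).
  case: n ww' => [//|n] ww' /=; rewrite /action_at (ww' n)//.
  by rewrite (depends_below_history ww').
transitivity (\int[state_kernel n w]_x
    \int[pi n (next_history n (w, x))]_a (\1_U (x, a))%:E); first by [].
rewrite (_ : state_kernel n w = state_kernel n w'); last first.
  case: n ww' {nww'} => [|n] ww'; first by rewrite !state_kernel0.
  by rewrite !state_kernelS (ww' n).
by apply: eq_integral => x _; rewrite nww'.
Qed.

Theorem exists_strategic_measure :
  exists P : probability Omega R, strategic_measure pi P.
Proof.
have [P PE] := ionescu_tulcea depends_below_coord_kernel.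
have mHA n : measurable_fun [set: Omega]
    (fun w => (history n w, action_at n w)).
  by apply: measurable_fun_pair; [exact: measurable_history|exact: measurable_action_at].
(* The three clauses of [strategic_measure] are all instances of this formula, for suitable [F]. *)
have PF n (F : hist X (borel A) n * borel A -> \bar R) : ge0mfun F ->
    \int[P]_w F (history n w, action_at n w) =
    \int[P]_w \int[state_kernel n w]_x
      \int[pi n (next_history n (w, x))]_a F (next_history n (w, x), a).
  move=> mF; have mFH := ge0mfun_comp (mHA n) mF.
  rewrite (PE n _ mFH); last first.
    move=> w w' ww' /=; rewrite (depends_below_history ww').
    by rewrite /action_at (ww' n).
  apply: eq_integral => w _.
  rewrite integral_pker_product; last first.
    exact: (ge0mfun_comp (measurable_update2 n w) mFH).
  apply: eq_integral => x _; apply: eq_integral => a _.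
  by rewrite /= history_update action_at_update.
exists P; split => [B mB|n B C mB mC|n B C mB mC].
- have mF : ge0mfun (fun z : hist X (borel A) 0 * borel A => (\1_B z.1)%:E : \bar R).
    exact: (@ge0mfun_comp _ _ (hist X (borel A) 0 * borel A)%type X R fst
      (fun x => (\1_B x)%:E) measurable_fst (ge0mfun_indic _ mB)).
  have mSB : measurable (state_at 0 @^-1` B : set Omega).
    by rewrite -[X in measurable X]setTI; exact: measurable_state_at.
  transitivity (\int[P]_w (\1_(state_at 0 @^-1` B) w)%:E).
    by rewrite integral_indic// setIT.
  rewrite [LHS](PF 0%N _ mF) /=.
  transitivity (\int[P]_w initial M B).
    apply: eq_integral => w _.
    transitivity (\int[initial M]_x (\1_B x)%:E).
      apply: eq_integral => x _.
      exact: (integral_pker_cst (pi 0%N) x).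
    by rewrite integral_indic// setIT.
  by rewrite integral_cst//= [X in _ * X](@probability_setT _ _ _ P) mule1.
- pose F (z : hist X (borel A) n * borel A) : \bar R :=
    (\1_B z.1)%:E * pi n z.1 C.
  have mF : ge0mfun F.
    split=> [z|]; first by rewrite mule_ge0// lee_fin.
    apply: emeasurable_funM.
      have [_ mB1] := @ge0mfun_indic _ _ R _ mB.
      exact: (measurableT_comp mB1 measurable_fst).
    exact: (measurableT_comp (measurable_kernel (pi n) C mC) measurable_fst).
  have mBC : ge0mfun (fun z : hist X (borel A) n * borel A =>
      (\1_(B `*` C) z)%:E : \bar R).
    by apply: ge0mfun_indic; exact: measurableX.
  have mHB : measurable (history n @^-1` B : set Omega).
    by rewrite -[X in measurable X]setTI; exact: measurable_history.
  have mAC : measurable (action_at n @^-1` C : set Omega).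
    by rewrite -[X in measurable X]setTI; exact: measurable_action_at.
  transitivity (\int[P]_w (\1_(B `*` C) (history n w, action_at n w))%:E).
    transitivity (\int[P]_w (\1_(history n @^-1` B `&` action_at n @^-1` C) w)%:E).
      by rewrite integral_indic ?setIT//; exact: measurableI.
    by apply: eq_integral => w _; rewrite !indicE in_setX in_setI.
  rewrite (PF n _ mBC).
  (* [F] has the indicator of [C] replaced by its conditional probability. It ignores the action, so
     integrating against the policy gives the same expression as for the rectangle. *)
  transitivity (\int[P]_w F (history n w, action_at n w)).
    rewrite (PF n _ mF); apply: eq_integral => w _; apply: eq_integral => x _.
    rewrite integral_setX//; apply/esym.
    exact: (integral_pker_cst (pi n) _ (F (next_history n (w, x), point))).
  rewrite [RHS]integral_mkcond; apply: eq_integral => w _.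
  rewrite patchE /F /= indicE.
  have -> : (w \in history n @^-1` B) = (history n w \in B).
    by apply/idP/idP; rewrite !inE.
  by case: ifP; rewrite ?mul1e ?mul0e.
- pose D := B `*` C.
  have mD : measurable D by exact: measurableX.
  (* The transition clause is read off one time later, with an integrand that ignores the last
     action. *)
  pose F (z : hist X (borel A) n.+1 * borel A) : \bar R := (\1_D z.1)%:E.
  have mF : ge0mfun F.
    exact: (@ge0mfun_comp _ _ (hist X (borel A) n.+1 * borel A)%type
      (hist X (borel A) n.+1) R fst (fun h => (\1_D h)%:E) measurable_fst
      (ge0mfun_indic _ mD)).
  have mHB : measurable ((fun w => (history n w, action_at n w)) @^-1` B : set Omega).
    by rewrite -[X in measurable X]setTI; exact: mHA.
  have mSC : measurable (state_at n.+1 @^-1` C : set Omega).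
    by rewrite -[X in measurable X]setTI; exact: measurable_state_at.
  transitivity (\int[P]_w F (history n.+1 w, action_at n.+1 w)).
    transitivity (\int[P]_w (\1_((fun w => (history n w, action_at n w)) @^-1` B
        `&` state_at n.+1 @^-1` C) w)%:E).
      by rewrite integral_indic ?setIT//; exact: measurableI.
    by apply: eq_integral => w _; rewrite /F !indicE /= in_setX in_setI.
  rewrite (PF n.+1 _ mF) [RHS]integral_mkcond; apply: eq_integral => w _.
  transitivity (\int[transition M (w n)]_x (\1_D (history n w, action_at n w, x))%:E).
    apply: eq_integral => x _.
    exact: (integral_pker_cst (pi n.+1) _ (F (next_history n.+1 (w, x), point))).
  rewrite integral_setX// patchE hist_last_history.
  rewrite (_ : (state_at n w, action_at n w) = w n); last first.
    by rewrite /state_at /action_at -surjective_pairing.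
  rewrite indicE.
  have -> : (w \in (fun w => (history n w, action_at n w)) @^-1` B) =
      ((history n w, action_at n w) \in B) by apply/idP/idP; rewrite !inE.
  by case: ifP; rewrite ?mul1e ?mul0e.
Qed.

End existence.
End strategic_measures.

Section integral_tools.
Local Open Scope ereal_scope.
Context d (T : measurableType d) (R : realType) (m : {measure set T -> \bar R}).

(** The integral of a nonnegative function is a supremum over the simple functions below it. Hence
    [hitting_time] can be integrated and compared without proving it measurable. *)
Lemma ge0_le_integral_nonmeasurable (f g : T -> \bar R) : (forall x, 0 <= f x) ->
  (forall x, f x <= g x) -> \int[m]_x f x <= \int[m]_x g x.
Proof.
move=> f0 fg; have g0 x : 0 <= g x by exact: le_trans (f0 x) (fg x).
rewrite !ge0_integralTE//; apply: ereal_sup_le => _ [h hf <-].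
by exists h => // x; exact: le_trans (hf x) (fg x).
Qed.

Lemma integral_mrestr (D : set T) (mD : measurable D) f : ge0mfun f ->
  \int[mrestr m mD]_x f x = \int[m]_x ((\1_D x)%:E * f x).
Proof.
have mD1 := @ge0mfun_indic _ _ R _ mD.
move=> mf; apply/esym; move: f mf.
apply: (@positive_functionalE _ _ _ (mrestr m mD)
  (fun f => \int[m]_x ((\1_D x)%:E * f x))) => [|U mU].
  apply: (@positive_functional_comp _ _ T T R _ (fun f x => (\1_D x)%:E * f x)).
  - exact: positive_functional_integral.
  - move=> f [f0 mf]; split=> [x|]; first by rewrite mule_ge0// lee_fin.
    by apply: emeasurable_funM => //; case: mD1.
  - move=> x; rewrite indicE; case: (x \in D) => /=.
      split=> [f g _ _|c f _ _|f g _ _ fg|g f _ _ gf]; rewrite ?mul1e//.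
      by under eq_fun do rewrite mul1e; exact: gf.
    split=> [f g _ _|c f _ _|f g _ _ fg|g f _ _ gf]; rewrite ?mul0e ?adde0 ?mule0//.
    by under eq_fun do rewrite mul0e; exact: cvg_cst.
transitivity (\int[m]_x (\1_(U `&` D) x)%:E).
  by apply: eq_integral => x _; rewrite -EFinM !indicE in_setI -natrM mulnb andbC.
by rewrite integral_indic ?setIT//; exact: measurableI.
Qed.

End integral_tools.

(** * Occupation laws and switching of policies *)

Section occupation.
Local Open Scope ereal_scope.
Context (R : realType) dX (X : measurableType dX) (A : ptopologicalType)
  (dim : nat) (M : control_model R X A dim) (Delta : set X).
Hypothesis mDelta : measurable Delta.
Local Notation Omega := (trajectory X (borel A)).
Local Notation XA := (X * borel A)%type.

(** Survival is encoded as a set of histories rather than of trajectories, so that the conditional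
    laws given the history apply to its indicator. *)
Fixpoint alive_hist n : set (hist X (borel A) n) :=
  match n return set (hist X (borel A) n) with
  | 0 => ~` Delta
  | m.+1 => [set h : hist X (borel A) m.+1 | alive_hist h.1.1 /\ ~ Delta h.2]
  end.

Lemma measurable_alive_hist n : measurable (@alive_hist n).
Proof.
elim: n => [|n IH]; first exact: measurableC.
rewrite (_ : alive_hist (n := n.+1) = (@alive_hist n `*` setT) `*` ~` Delta).
  by apply: measurableX; [exact: measurableX|exact: measurableC].
by apply/seteqP; split => -[[h a] x] /=; tauto.
Qed.

Definition alive n : set Omega := history n @^-1` @alive_hist n.

Lemma measurable_alive n : measurable (alive n).
Proof.
rewrite -[X in measurable X]setTI; apply: measurable_history => //.
exact: measurable_alive_hist.
Qed.

Lemma aliveP n w : alive n w <-> forall i, (i <= n)%N -> ~ Delta (state_at i w).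
Proof.
elim: n => [|n IH].
  split; first by move=> nD i; rewrite leqn0 => /eqP ->.
  by move/(_ _ (leqnn _)).
split.
  move=> [/IH al nD] i; rewrite leq_eqVlt => /predU1P[->//|]; exact: al.
move=> al; split; last exact: (al n.+1).
by apply/IH => i /leqW/al.
Qed.

Lemma lt_hitting_time n w : (n%:R%:E < hitting_time R Delta w) <-> alive n w.
Proof.
rewrite aliveP; split.
  move=> nT i i_n Di; have : hitting_time R Delta w <= i%:R%:E.
    by apply: ereal_inf_lbound; exists i.
  by rewrite leNgt (le_lt_trans _ nT)// lee_fin ler_nat.
move=> al; apply: (@lt_le_trans _ _ n.+1%:R%:E).
  by rewrite lte_fin ltr_nat.
apply: le_ereal_inf_tmp => _ [i /= Di <-]; rewrite lee_fin ler_nat ltnNge.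
by apply/negP => /al.
Qed.

Section laws.
Variable (P : probability Omega R).

(** The sub-probability law of the pair at time [n] on the event that [Delta] has not been hit up to
    time [n]; occupancy is the series of these laws. *)
Definition occ_law n : {measure set XA -> \bar R} :=
  image_measure (@measurable_coord _ X _ (borel A) n)
    (mrestr P (measurable_alive n)).

Lemma integral_occ_law n f : ge0mfun f ->
  \int[occ_law n]_z f z = \int[P]_w ((\1_(@alive_hist n) (history n w))%:E * f (w n)).
Proof.
move=> mf; rewrite integral_image_measure// integral_mrestr//.
exact: (ge0mfun_comp (measurable_coord n) mf).
Qed.

Lemma occ_law_le1 n : occ_law n setT <= 1.
Proof.
rewrite image_measureE preimage_setT /= /mrestr setTI.
exact: probability_le1 (measurable_alive n).
Qed.

Lemma occupancyE G : measurable G -> occupancy Delta P G = \sum_(n <oo) occ_law n G.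
Proof.
move=> mG; rewrite /occupancy.
have mGn n : measurable ((fun w : Omega => w n) @^-1` G).
  by rewrite -[X in measurable X]setTI; exact: measurable_coord.
under eq_integral => w _.
  under eq_eseriesr => n _.
    rewrite (_ : [set w' | n%:R%:E < hitting_time R Delta w'] = alive n); last first.
      by apply/seteqP; split => w' /=; rewrite lt_hitting_time.
    rewrite (_ : [set w' | G (state_at n w', action_at n w')] =
        (fun w : Omega => w n) @^-1` G); last first.
      by apply/seteqP; split => w' /=; rewrite /state_at /action_at -surjective_pairing.
    rewrite -[(_ * _)%R]/((\1_(alive n) \* \1_((fun w : Omega => w n) @^-1` G)) w)%R.
    rewrite -indicI.
    over.
  over.
rewrite integral_nneseries//; last first.
  move=> n; apply/measurable_EFinP/measurable_indic/measurableI => //.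
  exact: measurable_alive.
apply: eq_eseriesr => n _; rewrite integral_indic//; last first.
  by apply: measurableI => //; exact: measurable_alive.
by rewrite setIT image_measureE /= /mrestr setIC.
Qed.

(** Markov's inequality: [n] times the surviving mass is at most the mean hitting time. *)
Lemma occ_law_cvg0 : \int[P]_w hitting_time R Delta w < +oo ->
  occ_law n setT @[n --> \oo] --> 0.
Proof.
move=> ET; set I := \int[P]_w _ in ET.
have T0 w : 0 <= hitting_time R Delta w.
  by apply: le_ereal_inf_tmp => _ [i _ <-]; rewrite lee_fin.
have I0 : 0 <= I by exact: integral_ge0.
have Ifin : I \is a fin_num by rewrite ge0_fin_numE.
have markovT n : n%:R%:E * occ_law n setT <= I.
  rewrite image_measureE preimage_setT /= /mrestr setTI.
  have mal := @ge0mfun_indic _ _ R _ (measurable_alive n).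
  have := pfunctionalZ (positive_functional_integral P) (ler0n R n) mal.
  rewrite integral_indic ?setIT//; last exact: measurable_alive.
  move=> <-; apply: ge0_le_integral_nonmeasurable => w.
    by rewrite mule_ge0// lee_fin.
  rewrite indicE; have [/[!inE] al|_] := boolP (w \in alive n).
    by rewrite mule1; apply/ltW/lt_hitting_time.
  by rewrite mule0.
have finl n : occ_law n setT \is a fin_num.
  by rewrite ge0_fin_numE// (le_lt_trans (occ_law_le1 n))// ltry.
apply/fine_cvgP; split; first exact: nearW.
have cI : (fine I * n.+1%:R^-1)%R @[n --> \oo] --> (0 : R)%R.
  rewrite -[X in _ --> X](mulr0 (fine I)); apply: cvgMr.
  exact: cvg_harmonic.
rewrite -(cvg_shiftS (fun n => fine (occ_law n setT))).
apply: (squeeze_cvgr _ (cvg_cst 0%R) cI); apply: nearW => n.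
apply/andP; split; first exact: fine_ge0.
rewrite -[leLHS]/(fine (occ_law n.+1 setT)) ler_pdivlMr// mulrC -lee_fin EFinM !fineK//.
Qed.

End laws.

End occupation.

Section strategic_laws.
Local Open Scope ereal_scope.
Context (R : realType) dX (X : measurableType dX) (A : ptopologicalType)
  (dim : nat) (M : control_model R X A dim) (Delta : set X).
Hypothesis mDelta : measurable Delta.
Local Notation Omega := (trajectory X (borel A)).
Local Notation XA := (X * borel A)%type.
Local Notation e := (occ_law mDelta).

Lemma measurable_history_action n :
  measurable_fun [set: Omega] (fun w => (history n w, action_at n w)).
Proof.
by apply: measurable_fun_pair; [exact: measurable_history|exact: measurable_action_at].
Qed.

Lemma measurable_last_pair n : measurable_fun
  [set: (hist X (borel A) n * borel A)%type] (fun ha => (hist_last ha.1, ha.2) : XA).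
Proof.
apply: measurable_fun_pair; last exact: measurable_snd.
apply: (@measurableT_comp _ _ _ (hist X (borel A) n * borel A)%type
  (hist X (borel A) n) X); first exact: measurable_hist_last.
exact: measurable_fst.
Qed.

Section one_policy.
Variables (pi : policy M) (P : probability Omega R).
Hypothesis piP : strategic_measure pi P.

Lemma integral_state0 f : ge0mfun f ->
  \int[P]_w f (state_at 0 w) = \int[initial M]_x f x.
Proof.
move=> mf; have [P0 _ _] := piP.
have mS := @measurable_state_at _ X _ (borel A) 0.
rewrite -(integral_image_measure mS P mf).
by apply: eq_measure_integral => U mU _; exact: P0.
Qed.

Lemma integral_action n f : ge0mfun f ->
  \int[P]_w f (history n w, action_at n w) =
  \int[P]_w \int[pi n (history n w)]_a f (history n w, a).
Proof.
have [_ Pa _] := piP.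
apply: conditional_law_integral; [exact: measurable_history|
  exact: measurable_action_at|exact: Pa].
Qed.

Lemma integral_state n f : ge0mfun f ->
  \int[P]_w f (history n w, action_at n w, state_at n.+1 w) =
  \int[P]_w \int[transition M (w n)]_x f (history n w, action_at n w, x).
Proof.
have [_ _ Ps] := piP => mf.
have := conditional_law_integral
  (k := pker_comap (@measurable_last_pair n) (transition M))
  (@measurable_history_action n) (@measurable_state_at _ X _ (borel A) n.+1)
  (Ps n) mf.
move=> ->; apply: eq_integral => w _; rewrite pker_comapE /= hist_last_history.
by rewrite /state_at /action_at -surjective_pairing.
Qed.

Lemma ge0mfunM d (T : measurableType d) (f g : T -> \bar R) :
  ge0mfun f -> ge0mfun g -> ge0mfun (fun x => f x * g x).
Proof.
move=> [f0 mf] [g0 mg]; split=> [x|]; first exact: mule_ge0.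
exact: emeasurable_funM.
Qed.

Definition off_Delta (f : X -> \bar R) x := (\1_(~` Delta) x)%:E * f x.

Lemma ge0mfun_off_Delta f : ge0mfun f -> ge0mfun (off_Delta f).
Proof.
by move=> mf; apply: ge0mfunM => //; apply: ge0mfun_indic; exact: measurableC.
Qed.

Lemma integral_occ_law0 f : ge0mfun f ->
  \int[e P 0]_z f z.1 = \int[initial M]_x off_Delta f x.
Proof.
move=> mf; have mf1 := @ge0mfun_comp _ _ XA X R fst f measurable_fst mf.
rewrite (integral_occ_law _ _ _ mf1) -(integral_state0 (ge0mfun_off_Delta mf)).
by [].
Qed.

(** Surviving to time [n + 1] means surviving to time [n] and then landing off [Delta]; only
    functions of the state are considered because the next action depends on the policy. *)
Lemma integral_occ_lawS n f : ge0mfun f ->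
  \int[e P n.+1]_z f z.1 =
  \int[e P n]_z \int[transition M z]_x off_Delta f x.
Proof.
move=> mf; have mf1 := @ge0mfun_comp _ _ XA X R fst f measurable_fst mf.
have mfD := ge0mfun_off_Delta mf.
rewrite (integral_occ_law _ _ _ mf1).
rewrite (integral_occ_law _ _ _ (ge0mfun_kernel (transition M) mfD)).
pose F (z : hist X (borel A) n * borel A * X) : \bar R :=
  (\1_(alive_hist Delta (n := n)) z.1.1)%:E * off_Delta f z.2.
have mal : ge0mfun (fun h : hist X (borel A) n =>
    (\1_(alive_hist Delta (n := n)) h)%:E : \bar R).
  by apply: ge0mfun_indic; exact: measurable_alive_hist.
have mF : ge0mfun F.
  apply: ge0mfunM.
    apply: (@ge0mfun_comp _ _ (hist X (borel A) n * borel A * X)%type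
      (hist X (borel A) n) R (fst \o fst) _ _ mal).
    exact: measurableT_comp measurable_fst measurable_fst.
  exact: (@ge0mfun_comp _ _ (hist X (borel A) n * borel A * X)%type
    X R snd _ measurable_snd mfD).
transitivity (\int[P]_w F (history n w, action_at n w, state_at n.+1 w)).
  apply: eq_integral => w _; rewrite /F /off_Delta /= muleA; congr (_ * _).
  rewrite -EFinM !indicE -natrM mulnb; congr ((nat_of_bool _)%:R%:E).
  apply/idP/andP => [/set_mem[al nD]|[/set_mem al /set_mem nD]].
    by split; apply/mem_set.
  by apply/mem_set; split.
rewrite (integral_state mF); apply: eq_integral => w _; rewrite /F /=.
have := pfunctionalZ (positive_functional_integral (transition M (w n))) _ mfD.
by move=> <-// .
Qed.

Lemma integral_occ_law_action n (phi : R.-pker X ~> borel A) f : ge0mfun f ->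
  (forall h C, pi n h C = phi (hist_last h) C) ->
  \int[e P n]_z f z = \int[e P n]_z \int[phi z.1]_a f (z.1, a).
Proof.
move=> mf piE.
have mal : ge0mfun (fun h : hist X (borel A) n =>
    (\1_(alive_hist Delta (n := n)) h)%:E : \bar R).
  by apply: ge0mfun_indic; exact: measurable_alive_hist.
have mg := ge0mfun_kernel_pair phi mf.
have mg1 := @ge0mfun_comp _ _ XA X R fst _ measurable_fst mg.
rewrite (integral_occ_law _ _ _ mf) (integral_occ_law _ _ _ mg1).
pose F (z : hist X (borel A) n * borel A) : \bar R :=
  (\1_(alive_hist Delta (n := n)) z.1)%:E * f (hist_last z.1, z.2).
pose G (z : hist X (borel A) n * borel A) : \bar R :=
  (\1_(alive_hist Delta (n := n)) z.1)%:E *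
    \int[phi (hist_last z.1)]_a f (hist_last z.1, a).
have mal1 := @ge0mfun_comp _ _ (hist X (borel A) n * borel A)%type _ R fst _
  measurable_fst mal.
have mF : ge0mfun F.
  apply: ge0mfunM; first exact: mal1.
  exact: (ge0mfun_comp (@measurable_last_pair n) mf).
have mG : ge0mfun G.
  apply: ge0mfunM; first exact: mal1.
  exact: (ge0mfun_comp (@measurable_last_pair n) mg1).
transitivity (\int[P]_w F (history n w, action_at n w)).
  apply: eq_integral => w _; rewrite /F /= hist_last_history.
  by rewrite /state_at /action_at -surjective_pairing.
transitivity (\int[P]_w G (history n w, action_at n w)); last first.
  by apply: eq_integral => w _; rewrite /G /= hist_last_history.
rewrite (integral_action mF) (integral_action mG).
apply: eq_integral => w _.
rewrite [RHS](integral_pker_cst (pi n) _ (G (history n w, point))) /F /G /=.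
have mfx : ge0mfun (fun a => f (hist_last (history n w), a)).
  by apply: ge0mfun_comp mf; exact: measurable_section.
have -> : \int[phi (hist_last (history n w))]_a f (hist_last (history n w), a) =
    \int[pi n (history n w)]_a f (hist_last (history n w), a).
  by apply: eq_measure_integral => C mC _; rewrite piE.
have := pfunctionalZ (positive_functional_integral (pi n (history n w))) _ mfx.
by move=> <-// .
Qed.

Lemma occ_law_admissible n : measurable (admissible_graph M) ->
  e P n (~` admissible_graph M) = 0.
Proof.
move=> mK; have mKc := measurableC mK.
pose f (z : hist X (borel A) n * borel A) : \bar R :=
  (\1_(~` admissible_graph M) (hist_last z.1, z.2))%:E.
have mf : ge0mfun f.
  exact: (ge0mfun_comp (@measurable_last_pair n) (ge0mfun_indic _ mKc)).
apply/eqP; rewrite -measure_le0.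
apply: (@le_trans _ _ (\int[P]_w f (history n w, action_at n w))).
  rewrite [leLHS](_ : _ = \int[e P n]_z (\1_(~` admissible_graph M) z)%:E);
    last by rewrite integral_indic ?setIT.
  rewrite (integral_occ_law _ _ _ (ge0mfun_indic _ mKc)).
  apply: ge0_le_integral_nonmeasurable => w; first by rewrite mule_ge0// lee_fin.
  rewrite /f /= hist_last_history /state_at /action_at -surjective_pairing.
  by rewrite -EFinM lee_fin ler_piMl// indicE lern1 leq_b1.
rewrite (integral_action mf) integral0_eq// => w _.
pose h := history n w.
transitivity (\int[pi n h]_a (\1_(~` admissible M (hist_last h)) a)%:E).
  by apply: eq_integral => a _; rewrite /f /= !indicE !in_setC.
have mAx := measurable_admissible M (hist_last h).
rewrite integral_indic ?setIT//; last exact: measurableC.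
have E : (1 : \bar R) = pi n h (~` admissible M (hist_last h)) + 1.
  transitivity (pi n h setT); first exact/esym/prob_kernel.
  rewrite addeC -(setUv (admissible M (hist_last h))).
  transitivity (pi n h (admissible M (hist_last h)) +
      pi n h (~` admissible M (hist_last h))).
    by apply: measureU => //; [exact: measurableC|exact: setICr].
  by congr (_ + _); exact: policy_admissible.
by rewrite -[LHS](@addeK _ 1)// -E subee.
Qed.

End one_policy.

End strategic_laws.

(** * Policies that agree up to a time, and switching to a stationary kernel *)

Section eq_policies.
Local Open Scope ereal_scope.
Context (R : realType) dX (X : measurableType dX) (A : ptopologicalType)
  (dim : nat) (M : control_model R X A dim) (Delta : set X).
Hypothesis mDelta : measurable Delta.
Local Notation Omega := (trajectory X (borel A)).
Local Notation XA := (X * borel A)%type.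
Local Notation e := (occ_law mDelta).

(** By induction: integrating out the last action and state leaves a function of a shorter history,
    expressed with the same kernels on both sides. *)
Lemma eq_integral_history (pi pi' : policy M) (P P' : probability Omega R) n :
  strategic_measure pi P -> strategic_measure pi' P' ->
  (forall m, (m < n)%N -> forall h C, pi m h C = pi' m h C) ->
  forall f, ge0mfun f -> \int[P]_w f (history n w) = \int[P']_w f (history n w).
Proof.
move=> piP piP'; elim: n => [|n IH] pi_eq f mf.
  have h0 (w : Omega) : history 0 w = state_at 0 w by [].
  by rewrite [LHS](integral_state0 piP mf) [RHS](integral_state0 piP' mf).
have mfQ : ge0mfun (fun z : (hist X (borel A) n * borel A)%type =>
    \int[transition M (hist_last z.1, z.2)]_x f (z, x)).
  exact: (@ge0mfun_kernel_pair _ _ (hist X (borel A) n * borel A)%type X R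
    (pker_comap (@measurable_last_pair _ X A n) (transition M)) f mf).
have mfa := ge0mfun_kernel_pair (pi n) mfQ.
have key (rho : policy M) (Q : probability Omega R) : strategic_measure rho Q ->
    (forall h C, pi n h C = rho n h C) ->
    \int[Q]_w f (history n.+1 w) = \int[Q]_w \int[pi n (history n w)]_a
      \int[transition M (hist_last (history n w), a)]_x f (history n w, a, x).
  move=> rhoQ rhoE; rewrite [LHS](integral_state rhoQ mf).
  transitivity (\int[Q]_w \int[rho n (history n w)]_a
      \int[transition M (hist_last (history n w), a)]_x f (history n w, a, x)).
    rewrite -[RHS](integral_action rhoQ mfQ); apply: eq_integral => w _.
    by rewrite /= hist_last_history /state_at /action_at -surjective_pairing.
  apply: eq_integral => w _; apply: eq_measure_integral => C mC _.
  by rewrite rhoE.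
rewrite (key _ _ piP)// (key _ _ piP')//; last exact: pi_eq.
by apply: (IH _ _ mfa) => m mn; apply: pi_eq; exact: ltnW.
Qed.

Lemma eq_integral_occ_law (pi pi' : policy M) (P P' : probability Omega R) n :
  strategic_measure pi P -> strategic_measure pi' P' ->
  (forall m, (m <= n)%N -> forall h C, pi m h C = pi' m h C) ->
  forall f, ge0mfun f -> \int[e P n]_z f z = \int[e P' n]_z f z.
Proof.
move=> piP piP' pi_eq f mf.
pose F (z : hist X (borel A) n * borel A) : \bar R :=
  (\1_(alive_hist Delta (n := n)) z.1)%:E * f (hist_last z.1, z.2).
have mal : ge0mfun (fun h : hist X (borel A) n =>
    (\1_(alive_hist Delta (n := n)) h)%:E : \bar R).
  by apply: ge0mfun_indic; exact: measurable_alive_hist.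
have mal1 := @ge0mfun_comp _ _ (hist X (borel A) n * borel A)%type _ R fst _
  measurable_fst mal.
have mF : ge0mfun F.
  apply: ge0mfunM; first exact: mal1.
  exact: (ge0mfun_comp (@measurable_last_pair _ X A n) mf).
have key (Q : probability Omega R) :
    \int[e Q n]_z f z = \int[Q]_w F (history n w, action_at n w).
  rewrite (integral_occ_law _ _ _ mf); apply: eq_integral => w _.
  by rewrite /F /= hist_last_history /state_at /action_at -surjective_pairing.
rewrite !key (integral_action piP mF) (integral_action piP' mF).
transitivity (\int[P']_w \int[pi n (history n w)]_a F (history n w, a)).
  apply: (eq_integral_history piP piP') (ge0mfun_kernel_pair (pi n) mF).
  by move=> m mn; apply: pi_eq; exact: ltnW.
apply: eq_integral => w _; apply: eq_measure_integral => C mC _.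
exact: pi_eq.
Qed.

Section switching.
Variables (phi : R.-pker X ~> borel A) (pi : policy M).
Hypothesis phiA : forall x, phi x (admissible M x) = 1.

(** The actions at times below [t] come from [pi], the later ones from [phi]; [t = 0] gives the
    stationary policy of [phi]. *)
Definition switch_kernel (t n : nat) : R.-pker hist X (borel A) n ~> borel A :=
  if (n < t)%N then pi n else pker_comap (@measurable_hist_last _ X _ (borel A) n) phi.

Lemma switch_admissible t n (h : hist X (borel A) n) :
  switch_kernel t n h (admissible M (hist_last h)) = 1.
Proof. by rewrite /switch_kernel; case: ifP => _; [exact: policy_admissible|exact: phiA]. Qed.

Definition switch_policy t : policy M :=
  @Policy R dX X A dim M (switch_kernel t) (@switch_admissible t).

(** The transition operator of the chain of pairs that follows [phi] and is killed on [Delta]. Its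
    iterates on the constant 1 are the survival probabilities. *)
Definition step_back (f : XA -> \bar R) (z : XA) : \bar R :=
  \int[transition M z]_x off_Delta Delta (fun x => \int[phi x]_a f (x, a)) x.

Lemma ge0mfun_step_back f : ge0mfun f -> ge0mfun (step_back f).
Proof.
move=> mf; apply: ge0mfun_kernel; apply: ge0mfun_off_Delta => //.
exact: ge0mfun_kernel_pair.
Qed.

Lemma ge0mfun_iter_step_back n f : ge0mfun f -> ge0mfun (iter n step_back f).
Proof. by move=> mf; elim: n => [//|n IH] /=; exact: ge0mfun_step_back. Qed.

Lemma le_step_back f g : ge0mfun f -> ge0mfun g -> (forall z, f z <= g z) ->
  forall z, step_back f z <= step_back g z.
Proof.
move=> [f0 mf] [g0 mg] fg z.
apply: ge0_le_integral_nonmeasurable => x.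
  by rewrite /off_Delta mule_ge0// ?lee_fin// integral_ge0.
rewrite /off_Delta lee_wpmul2l// ?lee_fin//.
by apply: ge0_le_integral_nonmeasurable.
Qed.

Lemma le_iter_step_back n f g : ge0mfun f -> ge0mfun g -> (forall z, f z <= g z) ->
  forall z, iter n step_back f z <= iter n step_back g z.
Proof.
by move=> mf mg fg; elim: n => [//|n IH]; apply: le_step_back => //;
  exact: ge0mfun_iter_step_back.
Qed.

Lemma ge0mfun_cst1 d (T : measurableType d) : ge0mfun (fun _ : T => 1%:E : \bar R).
Proof. by split => // x; rewrite lee_fin. Qed.

Lemma step_back1_le1 z : step_back (fun=> 1) z <= 1.
Proof.
rewrite -[leRHS](integral_pker_cst (transition M) z 1).
apply: ge0_le_integral_nonmeasurable => x.
  by rewrite /off_Delta mule_ge0// ?lee_fin// integral_ge0.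
by rewrite /off_Delta integral_pker_cst mule1 lee_fin indicE lern1 leq_b1.
Qed.

Lemma nonincreasing_iter_step_back1 z :
  nonincreasing_seq (fun n => iter n step_back (fun=> 1) z).
Proof.
apply/nonincreasing_seqP => n; rewrite iterSr.
by apply: le_iter_step_back => [||z']; [exact/ge0mfun_step_back/ge0mfun_cst1|
  exact: ge0mfun_cst1|exact: step_back1_le1].
Qed.

Section switched_law.
Variables (t : nat) (P : probability Omega R).
Hypothesis tP : strategic_measure (switch_policy t) P.

(** The bound is on [n.+1] and not on [n]: the law at time [n] already contains its action, and
    [step_back] draws the action at time [n + 1]. *)
Lemma integral_occ_law_step n f : (t <= n.+1)%N -> ge0mfun f ->
  \int[e P n.+1]_z f z = \int[e P n]_z step_back f z.
Proof.
move=> tn mf; rewrite (integral_occ_law_action _ tP (phi := phi) mf); last first.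
  by move=> h C; rewrite /= /switch_kernel ltnNge tn.
by rewrite (integral_occ_lawS _ tP n (ge0mfun_kernel_pair phi mf)).
Qed.

Lemma integral_occ_law_iter s n f : (t <= s.+1)%N -> ge0mfun f ->
  \int[e P (s + n)]_z f z = \int[e P s]_z iter n step_back f z.
Proof.
move=> ts; elim: n f => [|n IH] f mf; first by rewrite addn0.
have tsn : (t <= (s + n).+1)%N by rewrite (leq_trans ts)// ltnS leq_addr.
rewrite addnS (integral_occ_law_step tsn mf).
by rewrite IH ?iterSr//; exact: ge0mfun_step_back.
Qed.

End switched_law.

(* These are the masses of the laws at times [s + n] under the policy that switches
   from [pi] to [phi] after time [s], and that policy is absorbed as well. *)
Lemma cvg_integral_iter_step_back (P : probability Omega R) s :
  absorbing M Delta -> strategic_measure pi P ->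
  \int[e P s]_z iter n step_back (fun=> 1) z @[n --> \oo] --> 0.
Proof.
(* Switching at [s.+1] leaves the actions up to time [s] to [pi], so the law at time [s] is that of
   [P], while every later action comes from [phi]. *)
move=> [_ absM] piP; have [P' P'P] := exists_strategic_measure (switch_policy s.+1).
have := occ_law_cvg0 mDelta (absM _ _ P'P).
rewrite -(cvg_shiftn s); apply: cvg_trans; apply: near_eq_cvg; near=> n.
transitivity (\int[e P' (s + n)]_z 1).
  by rewrite integral_cst// mul1e addnC.
rewrite (integral_occ_law_iter P'P n (leqnn _) (@ge0mfun_cst1 _ XA)).
apply: (eq_integral_occ_law P'P piP) => [m ms h C|].
  by rewrite /= /switch_kernel ltnS ms.
by apply: ge0mfun_iter_step_back; exact: ge0mfun_cst1.
Unshelve. all: by end_near. Qed.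

End switching.

End eq_policies.

(** * Disintegration along a kernel admissible at every state *)

Section admissible_disintegration.
Local Open Scope ereal_scope.
Context (R : realType) dX (X : measurableType dX) (A : ptopologicalType)
  (dim : nat) (M : control_model R X A dim).
Hypotheses (bA : borel_space R A) (cA : compact [set: A]).
Hypothesis MM : measurability_conditions M.
Local Notation XA := (X * borel A)%type.
Variable nu : {finite_measure set XA -> \bar R}.
Hypothesis nuK : nu (~` admissible_graph M) = 0.

Lemma admissible_disintegration : exists phi : R.-pker X ~> borel A,
  (forall x, phi x (admissible M x) = 1) /\
  forall f, ge0mfun f ->
    \int[nu]_z f z = \int[nu]_z \int[phi z.1]_a f (z.1, a).
Proof.
have [mK [theta [mtheta thetaA]]] := MM.
have [phi0 phi0E] := disintegration nu bA cA.
have intnu (psi : R.-pker X ~> borel A) :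
    (forall B C, measurable B -> measurable C ->
      nu (B `*` C) = \int[image_measure measurable_fst nu]_(x in B) psi x C) ->
    forall f, ge0mfun f ->
    \int[nu]_z f z = \int[nu]_z \int[psi z.1]_a f (z.1, a).
  move=> psiE f mf.
  have mg := ge0mfun_kernel_pair psi mf.
  rewrite -(integral_image_measure measurable_fst nu mg).
  rewrite (@integral_bind _ _ _ _ _ (image_measure measurable_fst nu)
    (graph_kernel psi) nu) //.
    by apply: eq_integral => x _; rewrite -(integral_graph_kernel psi x mf).
  move=> U mU; rewrite -(bind_measureE (image_measure measurable_fst nu)
    (graph_kernel psi) measurableT).
  apply: measure_prod_eq => //; first by rewrite ltey_eq fin_num_measure.
  move=> B C mB mC; rewrite [LHS](psiE B C mB mC) bind_measureE [LHS]integral_mkcond.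
  apply: eq_integral => x _; rewrite patchE.
  rewrite -[RHS]/(psi x ((fun a => (x, a)) @^-1` (B `*` C))).
  case: ifPn => [/[!inE] xB|/negP xB].
    by congr (psi x _); apply/seteqP; split => a //= [].
  rewrite (_ : _ @^-1` _ = set0) ?measure0//; apply/seteqP; split => a //= [Bx _].
  by apply: xB; rewrite inE.
have mKs (x : X) (psi : R.-pker X ~> borel A) :
    psi x (admissible M x) = psi x (xsection (admissible_graph M) x).
  by congr (psi x _); rewrite xsectionE.
(* A policy must be admissible at every state. On the exceptional set [N] the kernel is replaced by
   the Dirac mass at [theta x]. *)
pose N := [set x | phi0 x (admissible M x) != 1].
have mphiK : measurable_fun setT (fun x => phi0 x (admissible M x)).
  rewrite (_ : (fun x => _) = fun x => phi0 x (xsection (admissible_graph M) x)).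
    by apply: measurable_fun_xsection_finite_kernel; rewrite inE.
  by apply/funext => x; rewrite mKs.
have mN : measurable N.
  rewrite (_ : N = ~` (fun x => phi0 x (admissible M x)) @^-1` [set 1]).
    by apply: measurableC; rewrite -[X in measurable X]setTI; exact: mphiK.
  by apply/seteqP; split => x /= /eqP.
pose k (x : X) : {measure set (borel A) -> \bar R} :=
  if x \in N then [the measure _ _ of \d_(theta x)] else phi0 x.
have mk U : measurable U -> measurable_fun setT (k ^~ U).
  move=> mU; rewrite (_ : k ^~ U = fun x => if x \in N then \d_(theta x) U else phi0 x U).
    apply: measurable_fun_ifT => //.
    - by apply: (measurable_fun_bool true); rewrite setTI preimage_mem_true.
    - rewrite /dirac; apply/measurable_EFinP.
      by apply: (measurableT_comp (measurable_indic mU)); exact: mtheta.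
    - exact: measurable_kernel.
  by apply/funext => x; rewrite /k; case: ifP.
have k1 x : k x setT = 1.
  by rewrite /k; case: ifP => _; [exact: diracT|exact: prob_kernel].
exists (pker_of mk k1); split.
  move=> x; rewrite pker_ofE /k; case: ifPn => [_|/negP xN].
    transitivity ((theta x \in admissible M x)%:R%:E : \bar R); first exact: diracE.
    by rewrite mem_set//; exact: thetaA.
  by apply/eqP; apply: contrapT => /negP h; apply: xN; rewrite inE.
(* The mass of [nu] off the admissible graph is the integral of the inadmissible mass of [phi0];
   since it is 0, [N] is null and the replacement keeps the disintegration. *)
have nuN : image_measure measurable_fst nu N = 0.
  have mKc := measurableC mK.
  have := intnu phi0 phi0E _ (@ge0mfun_indic _ _ R _ mKc).
  rewrite integral_indic// setIT => /esym; rewrite [X in _ = X -> _]nuK => int0.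
  have mg := ge0mfun_kernel_pair phi0 (@ge0mfun_indic _ _ R _ mKc).
  have : \int[image_measure measurable_fst nu]_x
      `|\int[phi0 x]_a (\1_(~` admissible_graph M) (x, a))%:E| = 0.
    rewrite -[RHS]int0 -(integral_image_measure measurable_fst nu mg).
    by apply: eq_integral => x _; rewrite gee0_abs//; case: mg.
  case: mg => _ mg.
  move/(ae_eq_integral_abs _ measurableT mg) => [N' [mN' N'0 NN']].
  apply: (subset_measure0 mN mN') => // x /= xN; apply: NN' => /= /(_ I) h.
  move/negP: xN; apply; apply/eqP.
  have mAx := measurable_admissible M x.
  have phiC0 : phi0 x (~` admissible M x) = 0.
    rewrite -[RHS]h (eq_integral (fun a => (\1_(~` admissible M x) a)%:E)).
      by rewrite integral_indic ?setIT//; exact: measurableC.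
    by move=> a _; rewrite !indicE !in_setC.
  transitivity (phi0 x (admissible M x) + phi0 x (~` admissible M x)).
    by rewrite phiC0 adde0.
  transitivity (phi0 x setT); last exact: prob_kernel.
  rewrite -(setUv (admissible M x)); apply/esym.
  by apply: measureU => //; [exact: measurableC|exact: setICr].
apply: intnu => B C mB mC; rewrite [LHS](phi0E B C mB mC).
apply: ae_eq_integral => //.
- exact/measurable_funTS/measurable_kernel.
- exact/measurable_funTS/measurable_kernel.
exists N; split => // x /=; apply: contra_notP => xN _.
transitivity (k x C); last by [].
by rewrite /k ifF//; apply/negbTE/negP; rewrite inE.
Qed.

End admissible_disintegration.

(** * Dominated characteristic solutions are occupancy measures *)

Section occupation_of_characteristic.
Local Open Scope ereal_scope.
Context (R : realType) dX (X : measurableType dX) (A : ptopologicalType)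
  (dim : nat) (M : control_model R X A dim) (Delta : set X).
Hypotheses (bA : borel_space R A) (cA : compact [set: A]).
Hypotheses (MM : measurability_conditions M) (mDelta : measurable Delta).
Hypothesis absM : absorbing M Delta.
Local Notation Omega := (trajectory X (borel A)).
Local Notation XA := (X * borel A)%type.
Local Notation e := (occ_law mDelta).

Variables (pi : policy M) (P : probability Omega R).
Hypothesis piP : strategic_measure pi P.
Variables mu nu : {finite_measure set XA -> \bar R}.
Hypothesis muE : forall G, measurable G -> mu G = \sum_(n <oo) e P n G.
Hypothesis nu_mu : nu `<< mu.
Hypothesis nuK : nu (~` admissible_graph M) = 0.
Hypothesis nu_char : forall B, measurable B ->
  nu (B `*` setT) = initial M (B `&` ~` Delta) +
    \int[nu]_z transition M z (B `&` ~` Delta).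

(** The characteristic equation passes from sets to functions because it equates two measures on the
    state space. *)
Let nu_char_integral f : ge0mfun f ->
  \int[nu]_z f z.1 = \int[initial M]_x off_Delta Delta f x +
    \int[nu]_z \int[transition M z]_x off_Delta Delta f x.
Proof.
move=> mf; rewrite -(integral_image_measure measurable_fst nu mf).
have mDc := measurableC mDelta.
pose nuQ := bind_measure nu (transition M) measurableT.
pose m1 := mrestr (initial M) mDc.
pose m2 := mrestr nuQ mDc.
rewrite (eq_measure_integral (measure_add m1 m2)) => [|B mB _]; last first.
  transitivity (m1 B + m2 B); last exact/esym/measure_addE.
  transitivity (nu (B `*` setT)); last exact: nu_char.
  by rewrite image_measureE; congr (nu _); apply/seteqP; split => -[x a] //= [].
have [f0 mf1] := mf.
rewrite ge0_integral_measure_add// /m1 /m2 !integral_mrestr//; congr (_ + _).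
by rewrite (@integral_bind _ _ _ _ _ nu (transition M) nuQ)//;
  exact: ge0mfun_off_Delta.
Qed.

Section steps.
Variable phi : R.-pker X ~> borel A.
Hypothesis nu_phi : forall f, ge0mfun f ->
  \int[nu]_z f z = \int[nu]_z \int[phi z.1]_a f (z.1, a).
Hypothesis phiA : forall x, phi x (admissible M x) = 1.
Variable P0 : probability Omega R.
Hypothesis P0P : strategic_measure (switch_policy pi phiA 0) P0.

(** One round disintegrates [nu] along [phi] and rewrites its state marginal by the characteristic
    equation: the initial part is the law at time 0, the rest an integral of [step_back]. On the
    [n]-th iterate the initial part becomes the law at time [n]. *)
Lemma integral_nu_unfold n f : ge0mfun f ->
  \int[nu]_z f z = \sum_(i < n) \int[e P0 i]_z f z +
    \int[nu]_z iter n (step_back M Delta phi) f z.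
Proof.
move=> mf; have mphi := ge0mfun_kernel_pair phi.
have e0 g : ge0mfun g -> \int[nu]_z g z = \int[e P0 0]_z g z +
    \int[nu]_z step_back M Delta phi g z.
  move=> mg; rewrite (nu_phi mg) (nu_char_integral (mphi _ mg)).
  congr (_ + _).
  rewrite (integral_occ_law_action mDelta P0P (phi := phi) mg)//.
  by rewrite (integral_occ_law0 mDelta P0P (mphi _ mg)).
elim: n => [|n IH]; first by rewrite big_ord0 add0e.
rewrite IH big_ord_recr /= -addeA; congr (_ + _).
have mit := @ge0mfun_iter_step_back R _ X A dim M _ mDelta phi n f mf.
rewrite (e0 _ mit); congr (_ + _).
by rewrite -(integral_occ_law_iter mDelta P0P (s := 0%N) n isT mf).
Qed.

Lemma cvg_nu_iter : \int[nu]_z iter n (step_back M Delta phi) (fun=> 1) z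
  @[n --> \oo] --> 0.
Proof.
pose u n z := iter n (step_back M Delta phi) (fun=> 1) z.
have mu_ n : ge0mfun (u n).
  by apply: ge0mfun_iter_step_back => //; exact: ge0mfun_cst1.
have ndu z : nonincreasing_seq (u ^~ z).
  exact: nonincreasing_iter_step_back1.
have cu z : cvgn (u ^~ z) by exact: ereal_nonincreasing_is_cvgn.
pose v z := limn (u ^~ z).
have vu n z : v z <= u n z.
  by apply: lime_le => //; exists n => // p /= np; exact: ndu.
have v0 z : 0 <= v z.
  by apply: lime_ge => //; apply: nearW => n; case: (mu_ n).
have mv : measurable_fun setT v.
  by apply: (@emeasurable_fun_cvg _ _ _ _ u) => [n|z _]; [case: (mu_ n)|exact: cu].
(* [v] lies below every survival probability, and the integrals of these tend to 0. *)
have ev0 t : \int[e P t]_z v z = 0.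
  apply/eqP; rewrite eq_le integral_ge0// andbT.
  have c0 := cvg_integral_iter_step_back mDelta phiA t absM piP.
  rewrite -(cvg_lim _ c0)//; apply: lime_ge; first by apply/cvg_ex; exists 0.
  apply: nearW => n; apply: ge0_le_integral_nonmeasurable => // z; exact: vu.
have muv0 : \int[mu]_z v z = 0.
  rewrite (eq_measure_integral (mseries (e P) 0)) => [|G mG _]; last first.
    exact: muE.
  by rewrite ge0_integral_measure_series// eseries0.
have nuv : {ae nu, forall z, v z = 0}.
  have : {ae mu, forall z, v z = 0}.
    have : \int[mu]_z `|v z| = 0.
      by rewrite -[RHS]muv0; apply: eq_integral => z _; rewrite gee0_abs.
    by move/(ae_eq_integral_abs _ measurableT mv); apply: filterS => z /(_ I).
  move=> [N [mN N0 Nv]]; exists N; split => //.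
  by move/null_content_dominatesP : nu_mu; apply.
(* The constant 1 is an integrable bound because [nu] is finite. *)
have [] := @dominated_convergence _ _ _ nu setT measurableT u (fun=> 0) (fun=> 1).
- by move=> n; case: (mu_ n).
- exact: measurable_cst.
- apply: filterS nuv => z vz0 _; rewrite -[X in _ --> X]vz0; exact: cu.
- exact: finite_measure_integrable_cst.
- apply: nearW => z n _; rewrite gee0_abs; last by case: (mu_ n).
  by have := ndu z 0%N n (leq0n n).
- by move=> _ _; rewrite integral0.
Qed.

End steps.

Theorem characteristic_occupation : exists (pi' : policy M)
    (P' : probability Omega R), strategic_measure pi' P' /\
  forall G, measurable G -> nu G = \sum_(n <oo) e P' n G.
Proof.
have [phi [phiA nu_phi]] := admissible_disintegration bA cA MM nuK.
have [P0 P0P] := exists_strategic_measure (switch_policy pi phiA 0).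
exists (switch_policy pi phiA 0), P0; split => // G mG.
have mG1 := @ge0mfun_indic _ _ R _ mG.
pose r n := \int[nu]_z iter n (step_back M Delta phi) (fun z => (\1_G z)%:E) z.
have nuG n : nu G = \sum_(i < n) e P0 i G + r n.
  have := integral_nu_unfold nu_phi P0P n mG1.
  rewrite integral_indic// setIT => ->; congr (_ + _).
  by apply: eq_bigr => i _; rewrite integral_indic// setIT.
have mr n : ge0mfun (iter n (step_back M Delta phi) (fun z => (\1_G z)%:E)).
  exact: ge0mfun_iter_step_back.
have r0 n : 0 <= r n by apply: integral_ge0 => z _; case: (mr n).
(* The remainder for the indicator of [G] is squeezed below the one for the constant 1. *)
have cr : r n @[n --> \oo] --> 0.
  apply: (squeeze_cvge _ (cvg_cst 0) (cvg_nu_iter phiA)); apply: nearW => n.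
  rewrite r0/=; apply: ge0_le_integral_nonmeasurable => z; first by case: (mr n).
  apply: le_iter_step_back => //.
  by move=> z'; rewrite lee_fin indicE lern1 leq_b1.
have rfin n : r n \is a fin_num.
  rewrite ge0_fin_numE//; apply: (@le_lt_trans _ _ (nu G)).
    by rewrite (nuG n) leeDr// sume_ge0.
  by rewrite ltey_eq fin_num_measure.
apply/esym/cvg_lim => //.
rewrite (_ : (fun n => _) = fun n => nu G - r n); last first.
  by apply/funext => n; rewrite (nuG n) addeK// big_mkord.
rewrite -[X in _ --> X](@sube0 _ (nu G)); apply: cvgeB; [|exact: cvg_cst|exact: cr].
by rewrite oppe0 fin_num_adde_defl.
Qed.

End occupation_of_characteristic.

(** * Signed measures and the flow equation *)

Section signed_measure_algebra.
Context d (T : measurableType d) (R : realType).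
Implicit Types (m : signed_measure T R) (B : set T).

Lemma signed_measure0E B : (0 : signed_measure T R) B = 0.
Proof. by []. Qed.

Lemma signed_measureDE m1 m2 B : (m1 + m2) B = m1 B + m2 B.
Proof. by []. Qed.

Lemma signed_measureNE m B : (- m) B = - m B.
Proof. by []. Qed.

Lemma signed_measureZE (a : R) m B : (a *: m) B = a * m B.
Proof. by []. Qed.

Definition signed_measureE :=
  (signed_measure0E, signed_measureDE, signed_measureNE, signed_measureZE).

Lemma signed_measure_eq m1 m2 : (forall B, measurable B -> m1 B = m2 B) -> m1 = m2.
Proof.
move=> m12; apply: val_inj; apply/funext => B /=.
have [mB|nB] := pselect (measurable B); first exact: m12.
have /asboolP[_ _ ->//] := valP m1; by have /asboolP[_ _ ->] := valP m2.
Qed.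

Section measure_of_signed.
Variable m : signed_measure T R.
Hypothesis m0 : 0 <=: m.

Definition signed_measure_measure (_ : 0 <=: m) (B : set T) : \bar R := (m B)%:E.
Let mu := signed_measure_measure m0.

Let mu0 : mu set0 = 0%E.
Proof. by have /asboolP[h _ _] := valP m; rewrite /mu /signed_measure_measure; congr EFin. Qed.

Let mu_ge0 B : (0 <= mu B)%E.
Proof.
rewrite lee_fin; have [mB|nB] := pselect (measurable B); first exact: m0 B mB.
by have /asboolP[_ _ ->] := valP m.
Qed.

Let mu_sigma_additive : semi_sigma_additive mu.
Proof. by have /asboolP[] := valP m. Qed.

HB.instance Definition _ := isMeasure.Build _ _ _ mu mu0 mu_ge0 mu_sigma_additive.

Let mu_fin : fin_num_fun mu. Proof. by []. Qed.

Definition measure_of : {finite_measure set T -> \bar R} :=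
  finite_measure_of mu_fin.

Lemma measure_ofE B : measure_of B = (m B)%:E. Proof. by []. Qed.

End measure_of_signed.

Lemma addeBB (x y z t : \bar R) : z \is a fin_num ->
  ((x + y) - (z + t) = (x - z) + (y - t))%E.
Proof. by move=> zf; rewrite oppeD ?fin_num_adde_defr// addeACA. Qed.

Lemma oppeBB (x y : \bar R) : x \is a fin_num -> y \is a fin_num ->
  (- (x - y) = y - x)%E.
Proof.
move=> xf yf; rewrite -(fineK xf) -(fineK yf).
exact: (congr1 EFin (opprB (fine x) (fine y))).
Qed.

Lemma muleBB (a : R) (x y : \bar R) : x \is a fin_num -> y \is a fin_num ->
  (a%:E * (x - y) = a%:E * x - a%:E * y)%E.
Proof.
move=> xf yf; rewrite -(fineK xf) -(fineK yf).
exact: (congr1 EFin (mulrBr a (fine x) (fine y))).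
Qed.

Section signed_integral_linear.
Local Open Scope ereal_scope.
Variable f : T -> \bar R.
Hypotheses (mf : ge0mfun f) (f1 : forall x, f x <= 1).

Lemma integral_le1_fin (p : {finite_measure set T -> \bar R}) :
  \int[p]_x f x \is a fin_num.
Proof.
have [f0 _] := mf; rewrite ge0_fin_numE ?integral_ge0//.
apply: (@le_lt_trans _ _ (\int[p]_x 1)).
  exact: ge0_le_integral_nonmeasurable.
by rewrite integral_cst// mul1e ltey_eq fin_num_measure.
Qed.

(** Any decomposition into finite measures computes the integral: moving the negative parts across
    gives an equality of positive measures. Linearity follows without comparing Jordan
    decompositions of sums. *)
Lemma signed_integralE m (p q : {finite_measure set T -> \bar R}) :
  (forall B, measurable B -> (m B)%:E = p B - q B) ->
  signed_integral m f = \int[p]_x f x - \int[q]_x f x.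
Proof.
move=> mE; have [f0 mf1] := mf.
pose jp : {finite_measure set T -> \bar R} := jordan_pos (hahn m).
pose jn : {finite_measure set T -> \bar R} := jordan_neg (hahn m).
rewrite -[LHS]/(\int[jp]_x f x - \int[jn]_x f x).
have jE B : measurable B -> (m B)%:E = jp B - jn B.
  by move=> mB; rewrite -[LHS]/(charge_of m B) (jordan_decomp (hahn m) mB) /=
    /cadd/= cscaleN1.
have pjE B : measurable B -> p B + jn B = jp B + q B.
  move=> mB; have := jE B mB; rewrite (mE B mB).
  rewrite -(fineK (fin_num_measure p B mB)) -(fineK (fin_num_measure q B mB)).
  rewrite -(fineK (fin_num_measure jp B mB)) -(fineK (fin_num_measure jn B mB)).
  by rewrite -!EFinB => -[] h; rewrite -!EFinD; congr (_%:E); lra.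
have : \int[measure_add p jn]_x f x = \int[measure_add jp q]_x f x.
  apply: eq_measure_integral => C mC _.
  transitivity (p C + jn C); first exact: measure_addE.
  by rewrite pjE//; exact/esym/measure_addE.
rewrite !ge0_integral_measure_add//.
rewrite -(fineK (integral_le1_fin p)) -(fineK (integral_le1_fin q)).
rewrite -(fineK (integral_le1_fin jp)) -(fineK (integral_le1_fin jn)).
by rewrite -!EFinD => -[h]; congr (_%:E); lra.
Qed.

Lemma signed_integral_ge0 m (m0 : (0 <=: m)%R) :
  signed_integral m f = \int[measure_of m0]_x f x.
Proof.
rewrite (@signed_integralE m (measure_of m0) mzero).
  by rewrite integral_measure_zero sube0.
by move=> B mB; rewrite /mzero sube0.
Qed.

Lemma signed_integralP m : exists p q : {finite_measure set T -> \bar R},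
  (forall B, measurable B -> (m B)%:E = p B - q B) /\
  signed_integral m f = \int[p]_x f x - \int[q]_x f x.
Proof.
exists (jordan_pos (hahn m)), (jordan_neg (hahn m)); split => // B mB.
by rewrite -[LHS]/(charge_of m B) (jordan_decomp (hahn m) mB) /= /cadd/= cscaleN1.
Qed.

Lemma signed_integralD m1 m2 :
  signed_integral (m1 + m2)%R f = signed_integral m1 f + signed_integral m2 f.
Proof.
have [p1 [q1 [mE1 ->]]] := signed_integralP m1.
have [p2 [q2 [mE2 ->]]] := signed_integralP m2.
have [f0 mf1] := mf.
have padd (p q : {finite_measure set T -> \bar R}) : fin_num_fun (measure_add p q).
  move=> B mB; rewrite [X in X \is a _](measure_addE p q B) fin_numD.
  by rewrite !fin_num_measure.
rewrite (@signed_integralE _ (finite_measure_of (padd p1 p2))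
  (finite_measure_of (padd q1 q2))) => [|B mB].
  have iadd (p q : {finite_measure set T -> \bar R}) :
      \int[finite_measure_of (padd p q)]_x f x = \int[p]_x f x + \int[q]_x f x.
    exact: ge0_integral_measure_add.
  rewrite (iadd p1) (iadd q1).
  by apply: addeBB; exact: integral_le1_fin.
transitivity ((p1 B + p2 B) - (q1 B + q2 B)).
  rewrite signed_measureDE EFinD mE1// mE2//.
  by apply/esym; apply: addeBB; exact: fin_num_measure.
by congr (_ - _); exact/esym/measure_addE.
Qed.

Lemma signed_integralN m : signed_integral (- m)%R f = - signed_integral m f.
Proof.
have [p [q [mE ->]]] := signed_integralP m.
rewrite (@signed_integralE (- m)%R q p) => [|B mB].
  by apply/esym; apply: oppeBB; exact: integral_le1_fin.
by rewrite signed_measureNE EFinN mE//; apply: oppeBB; exact: fin_num_measure.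
Qed.

Lemma signed_integralZ (a : R) m :
  signed_integral (a *: m)%R f = a%:E * signed_integral m f.
Proof.
wlog a0 : a / (0 <= a)%R.
  move=> H; have [/H//|/ltW a0] := leP 0%R a.
  rewrite -[in LHS](opprK a) scaleNr signed_integralN H ?oppr_ge0//.
  by rewrite EFinN mulNe oppeK.
have [p [q [mE ->]]] := signed_integralP m.
have [f0 mf1] := mf.
have pscale (p0 : {finite_measure set T -> \bar R}) :
    fin_num_fun (mscale (NngNum a0) p0).
  by move=> B mB; rewrite /mscale/= fin_numM// fin_num_measure.
rewrite (@signed_integralE _ (finite_measure_of (pscale p))
  (finite_measure_of (pscale q))) => [|B mB].
  have iscale (p0 : {finite_measure set T -> \bar R}) :
      \int[finite_measure_of (pscale p0)]_x f x = a%:E * \int[p0]_x f x.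
    exact: (ge0_integral_mscale p0 measurableT (NngNum a0)).
  rewrite (iscale p) (iscale q).
  by apply/esym; apply: muleBB; exact: integral_le1_fin.
transitivity (a%:E * p B - a%:E * q B); last by [].
by rewrite signed_measureZE EFinM mE//; apply: muleBB; exact: fin_num_measure.
Qed.

End signed_integral_linear.

End signed_measure_algebra.

Section occupation_and_characteristic.
Local Open Scope ereal_scope.
Context (R : realType) dX (X : measurableType dX) (A : ptopologicalType)
  (dim : nat) (M : control_model R X A dim) (Delta : set X).
Hypothesis mDelta : measurable Delta.
Local Notation XA := (X * borel A)%type.
Local Notation e := (occ_law mDelta).
Implicit Types mu nu gamma : signed_measure XA R.

Section flow.
Variables (B : set X) (mB : measurable B).
Let f (z : XA) := transition M z (B `&` ~` Delta).

Let mf : ge0mfun f.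
Proof.
split => // ; apply: measurable_kernel; apply: measurableI => //.
exact: measurableC.
Qed.

Let f1 z : f z <= 1.
Proof.
rewrite -(prob_kernel (s := transition M) z); apply: le_measure; rewrite ?inE//.
by apply: measurableI => //; exact: measurableC.
Qed.

Lemma kernel_pushD nu1 nu2 : kernel_push M Delta (nu1 + nu2)%R B =
  kernel_push M Delta nu1 B + kernel_push M Delta nu2 B.
Proof. exact: signed_integralD. Qed.

Lemma kernel_pushZ a nu :
  kernel_push M Delta (a *: nu)%R B = a%:E * kernel_push M Delta nu B.
Proof. exact: signed_integralZ. Qed.

Lemma kernel_pushN nu : kernel_push M Delta (- nu)%R B = - kernel_push M Delta nu B.
Proof. exact: signed_integralN. Qed.

Lemma kernel_push_ge0 nu (nu0 : (0 <=: nu)%R) : kernel_push M Delta nu B =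
  \int[measure_of nu0]_z transition M z (B `&` ~` Delta).
Proof. exact: signed_integral_ge0. Qed.

Lemma initial_fin_num : initial M (B `&` ~` Delta) \is a fin_num.
Proof.
by apply: fin_num_measure; apply: measurableI => //; exact: measurableC.
Qed.

End flow.

Lemma flow_invariantZD a nu1 nu2 : flow_invariant M Delta nu1 ->
  flow_invariant M Delta nu2 -> flow_invariant M Delta (a *: nu1 + nu2)%R.
Proof.
move=> h1 h2 B mB; rewrite kernel_pushD// kernel_pushZ// -h1// -h2//.
Qed.

Lemma flow_invariant0 : flow_invariant M Delta (0%R : signed_measure XA R).
Proof.
move=> B mB; rewrite -(scale0r (0%R : signed_measure XA R)) kernel_pushZ// mul0e.
by rewrite scale0r.
Qed.

Lemma flow_invariantB_characteristic nu1 nu2 :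
  characteristic_solutions M Delta nu1 -> characteristic_solutions M Delta nu2 ->
  flow_invariant M Delta (nu1 - nu2)%R.
Proof.
move=> [_ _ h1] [_ _ h2] B mB; rewrite kernel_pushD// kernel_pushN//.
rewrite -[LHS]/(marginal nu1 B - marginal nu2 B) h1// h2//.
rewrite addeBB ?initial_fin_num// subee ?initial_fin_num// add0e//.
Qed.

Lemma characteristicD_flow nu gamma :
  characteristic_solutions M Delta nu -> flow_invariant M Delta gamma ->
  (0 <=: nu + gamma)%R -> (nu + gamma)%R (~` admissible_graph M) = 0%R ->
  characteristic_solutions M Delta (nu + gamma)%R.
Proof.
move=> [_ _ h] hg ng0 ngK; split => // B mB.
rewrite kernel_pushD// addeA -h// -hg//.
Qed.

(** The term at time 0 of the series gives the initial distribution off [Delta], and the remaining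
    terms, shifted by one, are the push of the whole series. *)
Lemma occupation_characteristic mu : measurable (admissible_graph M) ->
  occupancy_measures M Delta mu -> characteristic_solutions M Delta mu.
Proof.
move=> mK [pi [P [piP muE]]].
have {}muE G : measurable G -> (mu G)%:E = \sum_(n <oo) e P n G.
  by move=> mG; rewrite muE// (occupancyE mDelta).
have mu0 : (0 <=: mu)%R.
  by move=> G mG; rewrite -lee_fin muE//; exact: nneseries_ge0.
split => // [|B mB].
  have := muE _ (measurableC mK); rewrite eseries0 => [[]//|i _ _].
  exact: (occ_law_admissible mDelta piP).
have mB1 := @ge0mfun_indic _ _ R _ mB.
have mBT : measurable (B `*` [set: borel A]) by exact: measurableX.
have eBT n : e P n (B `*` setT) = \int[e P n]_z (\1_B z.1)%:E.
  transitivity (\int[e P n]_z (\1_(B `*` [set: borel A]) z)%:E).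
    by rewrite integral_indic ?setIT.
  by apply: eq_integral => z _; rewrite !indicE in_setX in_setT andbT.
have off1 (m : {measure set X -> \bar R}) :
    \int[m]_x off_Delta Delta (fun x => (\1_B x)%:E) x = m (B `&` ~` Delta).
  rewrite -(integral_mrestr m (measurableC mDelta) mB1) integral_indic//.
  by rewrite setIT.
rewrite /marginal muE// (kernel_push_ge0 mB mu0).
rewrite nneseries_recl//.
congr (_ + _).
  by rewrite eBT (integral_occ_law0 mDelta piP mB1) off1.
rewrite (eq_measure_integral (mseries (e P) 0)) => [|G mG _]; last exact: muE.
rewrite ge0_integral_measure_series//; last first.
  apply: measurable_kernel; apply: measurableI => //; exact: measurableC.
rewrite -nneseries_addn//.
apply: eq_eseriesr => n _; rewrite addn1 eBT (integral_occ_lawS mDelta piP n mB1).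
by apply: eq_integral => z _; rewrite off1.
Qed.

Lemma dominated_occupation mu nu (c : R) : borel_space R A -> compact [set: A] ->
  measurability_conditions M -> absorbing M Delta ->
  occupancy_measures M Delta mu -> characteristic_solutions M Delta nu ->
  (nu <=: c *: mu)%R -> occupancy_measures M Delta nu.
Proof.
move=> bA cA MM absM Omu [nu0 nuK nuC] nu_mu.
have [mu0 _ _] := occupation_characteristic MM.1 Omu.
have [pi [P [piP muE]]] := Omu.
have muE' G : measurable G -> measure_of mu0 G = \sum_(n <oo) e P n G.
  by move=> mG; rewrite measure_ofE muE// (occupancyE mDelta).
have dom : measure_of nu0 `<< measure_of mu0.
  apply/null_content_dominatesP => B mB; rewrite !measure_ofE => -[muB].
  have := nu_mu B mB; rewrite signed_measureZE muB mulr0 => nuB.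
  by congr (_%:E); apply/eqP; rewrite eq_le nuB; exact: nu0 B mB.
have nuK' : measure_of nu0 (~` admissible_graph M) = 0.
  by rewrite measure_ofE nuK.
have nuC' B : measurable B -> measure_of nu0 (B `*` setT) =
    initial M (B `&` ~` Delta) +
      \int[measure_of nu0]_z transition M z (B `&` ~` Delta).
  by move=> mB; rewrite measure_ofE -kernel_push_ge0//; exact: nuC.
have [pi' [P' [piP' nuE]]] := characteristic_occupation bA cA MM absM piP
  muE' dom nuK' nuC'.
exists pi', P'; split => // G mG.
by rewrite (occupancyE mDelta)// -nuE.
Qed.

End occupation_and_characteristic.

(** * Convex geometry of dominated measures *)

Section dominated_convex_sets.
Context d (T : measurableType d) (R : realType).
Local Notation V := (signed_measure T R).
Implicit Types (x y z v nu gamma : V) (a b c t k : R).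

Variable flow : set V.
Hypothesis flow0 : flow 0.
Hypothesis flowZD : forall a x y, flow x -> flow y -> flow (a *: x + y).
Variable mu : V.
Hypothesis mu0 : 0 <=: mu.

Let mu_ge0 B : measurable B -> 0 <= mu B.
Proof. exact: mu0. Qed.

(** The face, written with a linear condition on [nu - mu]: the geometry needs only that [flow] is a
    linear subspace and [mu] is nonnegative. The characteristic equations return in
    [dominated_setE]. *)
Definition dominated_set : set V :=
  [set nu | [/\ 0 <=: nu, flow (nu - mu) & exists2 c, 1 < c & nu <=: c *: mu]].

Definition dominated_directions : set V :=
  [set nu | flow nu /\ exists2 c : R, 0 < c &
    - (c *: mu) <=: nu /\ nu <=: c *: mu].

Let flowZ a x : flow x -> flow (a *: x).
Proof. by move=> fx; rewrite -[X in flow X]addr0; exact: flowZD. Qed.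

Lemma dominated_set_mu : dominated_set mu.
Proof.
split=> //; first by rewrite subrr.
exists 2; first by lra.
by move=> B mB; rewrite signed_measureE; have := mu_ge0 mB; lra.
Qed.

Lemma convex_dominated_set t x y : 0 <= t -> t <= 1 ->
  dominated_set x -> dominated_set y -> dominated_set (t *: x + (1 - t) *: y).
Proof.
move=> t0 t1 [x0 fx [c c1 xc]] [y0 fy [c' c'1 yc]]; split.
- move=> B mB; rewrite !signed_measureE.
  have := x0 B mB; have := y0 B mB; rewrite !signed_measureE => yB xB.
  by rewrite addr_ge0// mulr_ge0// subr_ge0.
- rewrite (_ : _ - mu = t *: (x - mu) + (1 - t) *: (y - mu)); last first.
    by apply: signed_measure_eq => B _; rewrite !signed_measureE; ring.
  by apply: flowZD => //; exact: flowZ.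
(* A crude bound for [t * c + (1 - t) * c'] that also exceeds 1. *)
- exists (c + c'); first by lra.
  move=> B mB; have := mu_ge0 mB; have := x0 B mB; have := y0 B mB.
  have := xc B mB; have := yc B mB; rewrite !signed_measureE.
  move: (x B : R) (y B : R) (mu B : R) => xB yB mB' h1 h2 h3 h4 h5.
  nra.
Qed.

Lemma linear_dominated_directions : linear_subspace dominated_directions.
Proof.
split.
  split => //; exists 1 => //; split=> B mB; rewrite !signed_measureE;
  by have := mu_ge0 mB; lra.
move=> a x y [fx [c c0 [xc1 xc2]]] [fy [c' c'0 [yc1 yc2]]]; split.
  exact: flowZD.
exists (`|a| * c + c'); first by rewrite ltr_wpDl// mulr_ge0// ltW.
have xB B : measurable B -> `|a * x B| <= `|a| * c * mu B.
  move=> mB; rewrite normrM -mulrA ler_wpM2l// ler_norml.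
  by have := xc1 B mB; have := xc2 B mB; rewrite !signed_measureE => -> ->.
split=> B mB; have := xB B mB; rewrite ler_norml => /andP[h1 h2];
  have := yc1 B mB; have := yc2 B mB; rewrite !signed_measureE mulrDl; lra.
Qed.

Lemma affine_translate : affine_set [set gamma | dominated_directions (gamma - mu)].
Proof.
have [W0 WD] := linear_dominated_directions.
move=> x y t Wx Wy; rewrite /mkset.
rewrite (_ : _ - mu = t *: (x - mu) + ((1 - t) *: (y - mu) + 0)).
  by apply: (WD) => //; exact: WD.
by apply: signed_measure_eq => B _; rewrite !signed_measureE; ring.
Qed.

Lemma sub_dominated_translate :
  dominated_set `<=` [set gamma | dominated_directions (gamma - mu)].
Proof.
move=> x [x0 fx [c c1 xc]]; split => //; exists c; first by lra.
split=> B mB; have := mu_ge0 mB; have := x0 B mB; have := xc B mB;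
  rewrite !signed_measureE; first by nra.
by lra.
Qed.

Lemma aff_dominated_set :
  aff dominated_set = [set gamma | dominated_directions (gamma - mu)].
Proof.
apply/seteqP; split.
  by apply: smallest_sub; [exact: affine_translate|exact: sub_dominated_translate].
move=> gamma [fg [c c0 [gc1 gc2]]] L [Laff FL].
(* The factor keeps the perturbation within half of [mu], so [nu] stays in the set, and [gamma] lies
   on the line through [mu] and [nu]. *)
pose nu := mu + (2 * c)^-1 *: (gamma - mu).
have Fnu : dominated_set nu.
  have nuB B : measurable B -> 2^-1 * mu B <= nu B <= 2 * mu B.
    move=> mB; rewrite !signed_measureE.
    have := gc1 B mB; have := gc2 B mB; have := mu_ge0 mB; rewrite !signed_measureE.
    rewrite invfM; have : c^-1 * c = 1 by rewrite mulVf// gt_eqF.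
    have : 0 < c^-1 by rewrite invr_gt0.
    move: (c^-1) (gamma B : R) (mu B : R) => c' gB mB' c'0 cc m0 h1 h2.
    by apply/andP; split; nra.
  split.
  - move=> B mB; have /andP[+ _] := nuB B mB; have := mu_ge0 mB.
    by rewrite signed_measureE; lra.
  - by rewrite /nu addrAC subrr add0r; exact: flowZ.
  - by exists 2; [lra|move=> B mB; rewrite signed_measureE; have /andP[] := nuB B mB].
rewrite (_ : gamma = (2 * c) *: nu + (1 - 2 * c) *: mu).
  by apply: Laff; apply: FL => //; exact: dominated_set_mu.
apply: signed_measure_eq => B _; rewrite !signed_measureE; field.
by rewrite gt_eqF.
Qed.

Lemma parallel_dominated_set :
  parallel_subspace (aff dominated_set) dominated_directions.
Proof.
split; first exact: linear_dominated_directions.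
exists mu; rewrite aff_dominated_set; apply/seteqP; split.
  by move=> gamma Wg; exists (gamma - mu); rewrite ?subrKC// addrC subrK.
by move=> _ [v Wv <-]; rewrite /mkset addrAC subrr add0r.
Qed.

(** On the line through [mu] and [x] the set extends past [x], away from [mu], to some point [w];
    nonnegativity of [w] bounds [x] below by a multiple of [mu]. *)
Lemma rai_dominated_set_sub x : rai dominated_set x ->
  dominated_set x /\ exists2 c, 1 < c & c^-1 *: mu <=: x.
Proof.
move=> [Fx linex]; split => //.
(* For [x = mu] there is no such line, but the bound is clear. *)
have [->|/eqP xmu] := pselect (x = mu).
  exists 2; first by lra.
  by move=> B mB; rewrite !signed_measureE; have := mu_ge0 mB; lra.
pose g := [set mu + t *: (x - mu) | t in [set: R]].
have lg : is_line g by exists mu, (x - mu); rewrite subr_eq0.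
have gaff : g `<=` aff dominated_set.
  move=> _ [t _ <-] L [Laff FL].
  rewrite (_ : _ + _ = t *: x + (1 - t) *: mu); last first.
    by apply: signed_measure_eq => B _; rewrite !signed_measureE; ring.
  by apply: Laff; apply: FL => //; exact: dominated_set_mu.
have gx : g x by exists 1 => //; rewrite scale1r addrC subrK.
have [y [z [yz [t]]]] := linex g lg gaff gx.
rewrite /= in_itv/= => /andP[t0 t1] xE segF.
have [w [del [del0 Fw wE]]] : exists w del, [/\ 0 < del, dominated_set w &
    w = x + del *: (x - mu)].
  have seg s : 0 < s -> s < 1 -> open_segment y z ((1 - s) *: y + s *: z).
    by move=> s0 s1; exists s => //=; rewrite in_itv/= s0.
  (* The parameters [t / 2] and [(1 + t) / 2] give one point on each side of [x]. The orientation of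
     the segment relative to [x - mu] is unknown; the sign of [kap] tells which of the two lies
     beyond [x]. *)
  have [||[s _ sE] F1] := segF _ (seg (t / 2) _ _); [lra..|].
  have [||_ F2] := segF _ (seg ((1 + t) / 2) _ _); [lra..|].
  pose kap := (1 - s) * 2 / t.
  have zyE : z - y = kap *: (x - mu).
    have : (t / 2) *: (z - y) = (1 - s) *: (x - mu).
      have -> : (t / 2) *: (z - y) =
          x - ((1 - t / 2) *: y + (t / 2) *: z).
        rewrite -xE; apply: signed_measure_eq => B _; rewrite !signed_measureE.
        by field.
      rewrite -sE; apply: signed_measure_eq => B _; rewrite !signed_measureE.
      by ring.
    move/(congr1 (fun v => (2 / t) *: v)); rewrite !scalerA.
    rewrite (_ : 2 / t * (t / 2) = 1); last by field; rewrite gt_eqF.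
    by rewrite scale1r => ->; congr (_ *: _); rewrite /kap; ring.
  have kap0 : kap != 0.
    apply/eqP => k0; move: zyE; rewrite k0 scale0r => /eqP.
    by rewrite subr_eq0 eq_sym (negPf yz).
  have [kap_gt0|kap_lt0] : 0 < kap \/ kap < 0.
    by move: kap0; rewrite neq_lt => /orP[]; [right|left].
  - exists ((1 - (1 + t) / 2) *: y + ((1 + t) / 2) *: z), ((1 - t) / 2 * kap).
    split; [by rewrite mulr_gt0//; lra|exact: F2|].
    rewrite -(scalerA _ kap) -zyE -xE; apply: signed_measure_eq => B _.
    by rewrite !signed_measureE; field.
  - exists ((1 - t / 2) *: y + (t / 2) *: z), (- (t / 2) * kap).
    split; [by rewrite -mulrNN opprK mulr_gt0 ?oppr_gt0//; lra|exact: F1|].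
    rewrite -(scalerA _ kap) -zyE -xE; apply: signed_measure_eq => B _.
    by rewrite !signed_measureE; field.
have [w0 _ _] := Fw.
(* Nonnegativity of [w] reads [(1 + del) * x >= del * mu] on every measurable set. *)
exists ((1 + del) / del); first by rewrite ltr_pdivlMr//; lra.
move=> B mB; have := w0 B mB; rewrite wE !signed_measureE.
rewrite invf_div mulrAC ler_pdivrMr; last by lra.
by lra.
Qed.

Lemma rai_dominated_set_sup x c : dominated_set x -> 1 < c -> c^-1 *: mu <=: x ->
  rai dominated_set x.
Proof.
move=> Fx c1 xc; split => // g [p [v [v0 ->]]] gaff [t0 _ xE].
have [x0 fx [c' c'1 xc']] := Fx.
have [W0 WD] := linear_dominated_directions.
(* [v] is the difference of two points of the line, which lies in the affine hull. *)
have Wv : dominated_directions v.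
  rewrite aff_dominated_set in gaff.
  have W1 : dominated_directions (p + (t0 + 1) *: v - mu).
    by apply: gaff; exists (t0 + 1).
  have W2 : dominated_directions (p + t0 *: v - mu) by apply: gaff; exists t0.
  rewrite (_ : v = (- 1) *: (p + t0 *: v - mu) + (p + (t0 + 1) *: v - mu)).
    exact: WD.
  by apply: signed_measure_eq => B _; rewrite !signed_measureE; ring.
have [fv [k k0 [vk1 vk2]]] := Wv.
(* As [v] is within [k * mu], a multiple of [v] by at most [eps] is within [mu / c], which is below
   [x]. *)
pose eps := (c * k)^-1.
have ck0 : 0 < c * k by rewrite mulr_gt0//; lra.
have eps0 : 0 < eps by rewrite invr_gt0.
have near s : `|s| <= eps -> dominated_set (x + s *: v).
  move=> seps.
  have svB B : measurable B -> `|s * v B| <= c^-1 * mu B.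
    move=> mB; rewrite normrM.
    have -> : c^-1 * mu B = eps * (k * mu B).
      by rewrite /eps; field; rewrite !gt_eqF//; lra.
    apply: ler_pM => //; rewrite ler_norml.
    by have := vk1 B mB; have := vk2 B mB; rewrite !signed_measureE => -> ->.
  have c'i : c^-1 <= 1 by rewrite invf_le1; lra.
  split.
  - move=> B mB; have := svB B mB; have := xc B mB; rewrite !signed_measureE ler_norml.
    by move=> ? /andP[? ?]; lra.
  - rewrite addrAC; rewrite addrC; exact: flowZD.
  - exists (c' + 1); first by lra.
    move=> B mB; have := svB B mB; have := xc' B mB; have := mu_ge0 mB.
    rewrite !signed_measureE ler_norml => m0 h /andP[_ h2].
    have : c^-1 * mu B <= 1 * mu B by rewrite ler_wpM2r.
    by rewrite mulrDl; lra.
(* [x] is the midpoint of this segment, and the ends differ because [v] is nonzero. *)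
exists (x - eps *: v), (x + eps *: v); split.
- apply/eqP => h; move/eqP: v0; apply.
  have : (2 * eps) *: v = 0.
    transitivity ((x + eps *: v) - (x - eps *: v)); last by rewrite -h subrr.
    by apply: signed_measure_eq => B _; rewrite !signed_measureE; ring.
  by move/eqP; rewrite scaler_eq0 gt_eqF ?mulr_gt0//= => /eqP.
- exists 2^-1; first by rewrite /= in_itv/=; lra.
  by apply: signed_measure_eq => B _; rewrite !signed_measureE; field.
- move=> u [s /=]; rewrite in_itv/= => /andP[s0 s1] <-{u}.
  have E : (1 - s) *: (x - eps *: v) + s *: (x + eps *: v) =
      x + ((2 * s - 1) * eps) *: v.
    by apply: signed_measure_eq => B _; rewrite !signed_measureE; ring.
  rewrite E; split; last first.
    apply: near; rewrite normrM (gtr0_norm eps0) ler_piMl//; first exact: ltW.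
    by rewrite ler_norml; lra.
  exists (t0 + (2 * s - 1) * eps) => //.
  by rewrite -xE scalerDl addrA.
Qed.

End dominated_convex_sets.

(** * The face generated by an occupancy measure *)

Section generated_face.
Context (R : realType) dX (X : measurableType dX) (A : ptopologicalType)
  (dim : nat) (M : control_model R X A dim) (Delta : set X).
Hypotheses (bA : borel_space R A) (cA : compact [set: A]).
Hypotheses (MM : measurability_conditions M) (mDelta : measurable Delta).
Hypothesis absM : absorbing M Delta.
Local Notation V := (signed_measure (X * borel A)%type R).
Local Notation O := (occupancy_measures M Delta).
Local Notation C := (characteristic_solutions M Delta).
Variable mu : V.
Hypothesis Omu : O mu.

Let Cmu : C mu. Proof. by apply: occupation_characteristic Omu => //; case: MM. Qed.
Let mu0 : 0 <=: mu. Proof. by case: Cmu. Qed.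

Local Notation G := (dominated_set (flow_invariant M Delta) mu).

(** Domination by [mu] already forces a nonnegative [nu] to vanish off the admissible graph, and
    subtracting the equation of [mu] removes the initial distribution. *)
Lemma characteristic_dominatedP (nu : V) (c : R) : nu <=: c *: mu ->
  C nu <-> 0 <=: nu /\ flow_invariant M Delta (nu - mu).
Proof.
move=> nuc; split=> [Cnu|[nu0 fnu]].
  split; first by case: Cnu.
  exact: flow_invariantB_characteristic.
rewrite (_ : nu = mu + (nu - mu)); last by rewrite addrC subrK.
have mK : measurable (~` admissible_graph M) by apply: measurableC; case: MM.
apply: characteristicD_flow => //; rewrite addrC subrK//.
have := nuc _ mK; have := nu0 _ mK; rewrite !signed_measureE.
by have [_ -> _] := Cmu; rewrite mulr0 => h1 h2; apply/eqP; rewrite eq_le h1 h2.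
Qed.

Lemma dominated_setE :
  G = [set nu | C nu /\ exists2 c : R, 1 < c & nu <=: c *: mu].
Proof.
apply/seteqP; split=> nu.
  move=> [nu0 fnu [c c1 nuc]]; split; last by exists c.
  by apply/(characteristic_dominatedP nuc).
move=> [Cnu [c c1 nuc]].
by have /(characteristic_dominatedP nuc)[nu0 fnu] := Cnu; split => //; exists c.
Qed.

Lemma dominated_set_occupancy : G `<=` O.
Proof.
rewrite dominated_setE => nu [Cnu [c _ nuc]].
exact: dominated_occupation nuc.
Qed.

Lemma is_face_dominated_set : is_face O G.
Proof.
split.
- by exists mu; apply: dominated_set_mu => //; exact: flow_invariant0.
- move=> x y t /set_mem Gx /set_mem Gy; apply/mem_set.
  have t0 : 0 <= t%:num by [].
  have t1 : t%:num <= 1 by [].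
  apply: (convex_dominated_set _ (flow_invariantZD (M := M) mDelta) mu0 t0 t1 Gx Gy).
  exact: flow_invariant0.
- exact: dominated_set_occupancy.
have half x y z (t : R) : G x -> O y -> O z -> 0 < t -> t < 1 ->
    x = t *: y + (1 - t) *: z -> G y.
  rewrite dominated_setE => -[_ [c c1 xc]] Oy Oz t0 t1 xE.
  split; first by apply: occupation_characteristic Oy => //; case: MM.
  have [z0 _ _] : C z by apply: occupation_characteristic Oz => //; case: MM.
  (* Since [z] is nonnegative, [t * y <= x <= c * mu]. *)
  exists (c / t); first by rewrite ltr_pdivlMr// mul1r (lt_trans t1).
  move=> B mB; have := xc B mB; have := z0 B mB.
  rewrite xE !signed_measureE mulrAC ler_pdivlMr// => h1 h2.
  rewrite mulrC (le_trans _ h2)// lerDl mulr_ge0//; lra.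
move=> x y z t Gx Oy Oz t0 t1 xE; split.
  exact: (half x y z t) Gx Oy Oz t0 t1 xE.
apply: (half x z y (1 - t) Gx Oz Oy); [lra|lra|].
by rewrite xE subKr addrC.
Qed.

(** Minimality: each dominated [nu] is an end of a segment in the set of occupancy measures with
    [mu] in its interior, so every face containing [mu] contains [nu]. *)
Lemma face_generatedE : face_generated O mu = G.
Proof.
apply/seteqP; split.
  apply: smallest_sub; first exact: is_face_dominated_set.
  move=> _ ->; apply: dominated_set_mu => //; exact: flow_invariant0.
move=> nu Gnu E [faceE Emu].
have {}Emu : E mu by exact: Emu.
have [_ _ _ extE] := faceE.
have [nu0 fnu [c c1 nuc]] := Gnu.
(* The other end of the segment, chosen so that [mu] is the combination of [nu] and [z] with weight
   [c^-1] on [nu]; it is nonnegative because [nu <=: c *: mu]. *)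
pose z := (c - 1)^-1 *: (c *: mu - nu).
have c10 : 0 < c - 1 by lra.
have ci0 : 0 < (c - 1)^-1 by rewrite invr_gt0.
have Gz : G z.
  split.
  - move=> B mB; rewrite !signed_measureE mulr_ge0 ?(ltW ci0)//.
    by have := nuc B mB; rewrite !signed_measureE subr_ge0.
  - rewrite (_ : z - mu = (- (c - 1)^-1) *: (nu - mu) + 0).
      by apply: flow_invariantZD => //; exact: flow_invariant0.
    apply: signed_measure_eq => B _; rewrite /z !signed_measureE; field.
    by rewrite gt_eqF.
  - exists ((c - 1)^-1 * c).
      by rewrite mulrC ltr_pdivlMr//; lra.
    move=> B mB; rewrite !signed_measureE -mulrA ler_wpM2l ?(ltW ci0)//.
    by have := nu0 B mB; rewrite signed_measureE; lra.
have [] // := extE mu nu z c^-1 Emu (dominated_set_occupancy Gnu)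
  (dominated_set_occupancy Gz).
- by rewrite invr_gt0; lra.
- by rewrite invf_lt1; lra.
apply: signed_measure_eq => B _; rewrite /z !signed_measureE; field.
by rewrite !gt_eqF//; lra.
Qed.

End generated_face.

Theorem proposition3p2 (R : realType) (dX : measure_display)
    (X : measurableType dX) (A : ptopologicalType) (dim : nat)
    (M : control_model R X A dim) (Delta : set X)
    (mu : signed_measure (X * borel A)%type R) :
  (1 <= dim)%N -> borel_space R A -> compact [set: A] ->
  measurability_conditions M -> measurable Delta -> absorbing M Delta ->
  occupancy_measures M Delta mu ->
  let F := face_generated (occupancy_measures M Delta) mu in
  [/\ F = [set nu | characteristic_solutions M Delta nu /\
        exists2 c : R, 1 < c & nu <=: c *: mu],
      rai F = [set nu | characteristic_solutions M Delta nu /\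
        exists2 c : R, 1 < c & c^-1 *: mu <=: nu /\ nu <=: c *: mu],
      aff F = [set gamma : signed_measure (X * borel A)%type R |
        flow_invariant M Delta (gamma - mu) /\
        exists2 c : R, 0 < c &
          - (c *: mu) <=: gamma - mu /\ gamma - mu <=: c *: mu] &
      parallel_subspace (aff F) [set nu | flow_invariant M Delta nu /\
        exists2 c : R, 0 < c & - (c *: mu) <=: nu /\ nu <=: c *: mu]].
Proof.
move=> _ bA cA MM mDelta absM Omu F.
have flow0 : flow_invariant M Delta (0 : signed_measure (X * borel A)%type R).
  exact: flow_invariant0.
have flowZD := flow_invariantZD (M := M) mDelta.
have Cmu : characteristic_solutions M Delta mu.
  by apply: occupation_characteristic Omu => //; case: MM.
have mu0 : 0 <=: mu by case: Cmu.
have FG : F = dominated_set (flow_invariant M Delta) mu.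
  exact: face_generatedE.
have GE := dominated_setE MM mDelta Omu.
split.
- by rewrite FG.
- rewrite FG; apply/seteqP; split=> x.
    move=> /(rai_dominated_set_sub flow0 mu0)[Fx [c c1 xc]].
    move: (Fx); rewrite GE => -[Cx [c' c'1 xc']]; split => //.
    (* A single constant must serve both bounds; enlarging it weakens each of them. *)
    exists (c + c'); first by lra.
    split=> B mB; rewrite !signed_measureE.
      have := xc B mB; rewrite !signed_measureE; apply: le_trans.
      rewrite ler_wpM2r ?lef_pV2 ?posrE//; [exact: mu0 B mB|lra..].
    have := xc' B mB; rewrite !signed_measureE => h.
    by rewrite (le_trans h)// ler_wpM2r//; [exact: mu0 B mB|lra].
  move=> [Cx [c c1 [cx xc]]].
  apply: (rai_dominated_set_sup flow0 flowZD mu0 _ c1 cx).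
  by rewrite GE; split => //; exists c.
- by rewrite FG (aff_dominated_set flow0 flowZD mu0).
- by rewrite FG; exact: parallel_dominated_set.
Qed.
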